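(* For every $k\ge 2$, the field extension $\mathbb{Q}(d_k)/\mathbb{Q}$ (equivalently $\mathbb{Q}(d_k-2)/\mathbb{Q}$) is not a Galois extension. Consequently, $d_k$ is not a cyclotomic integer (it is not contained in any cyclotomic field).
   Context: Define $q_k(x)\in\mathbb{Z}[x]$ by $q_0(x)=x^2-5x+3$, $q_1(x)=(x^3-8x^2+17x-5)(x-1)$, and $q_k(x)=(x^2-4x+2)q_{k-1}(x)-q_{k-2}(x)$ for $k\ge 2$, and let $d_k$ be the largest real root of $q_k$. (In the source, $d_k$ is the square of the Perron–Frobenius eigenvalue of the graph $\Gamma_k$ in Haagerup's list, and the theorem is used with the Etingof–Nikshych–Ostrik cyclotomicity theorem to conclude that $\Gamma_k$ is not a principal graph of a subfactor for $k\ge 2$.) *)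

(* Defs.v *)
From HB Require Import structures.
From mathcomp Require Import all_boot all_order all_algebra all_field.
Set Implicit Arguments. Unset Strict Implicit. Unset Printing Implicit Defensive.
Import Order.TTheory GRing.Theory Num.Theory.
Local Open Scope ring_scope.

Definition q0 : {poly int} := 'X^2 - 5%:P * 'X + 3%:P.
Definition q1 : {poly int} :=
  ('X^3 - 8%:P * 'X^2 + 17%:P * 'X - 5%:P) * ('X - 1).
Definition qmul : {poly int} := 'X^2 - 4%:P * 'X + 2%:P.

Fixpoint qpair (k : nat) : {poly int} * {poly int} :=
  match k with
  | 0 => (q0, q1)
  | k'.+1 => let: (a, b) := qpair k' in (b, qmul * b - a)
  end.

Definition q (k : nat) : {poly int} := (qpair k).1.

Definition qC (k : nat) : {poly algC} := map_poly (intr : int -> algC) (q k).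

Definition largest_real_root (k : nat) (x : algC) : Prop :=
  [/\ x \is Num.real, root (qC k) x &
      forall y : algC, y \is Num.real -> root (qC k) y -> y <= x].

Definition in_Qadj (z x : algC) : Prop :=
  exists p : {poly rat}, x = (map_poly (ratr : rat -> algC) p).[z].

(* Main.v *)
Require Import Defs.
From HB Require Import structures.
From mathcomp Require Import all_boot all_order all_algebra all_field.
From mathcomp Require Import all_fingroup all_character.
From mathcomp Require Import ring zify.
Import Order.TTheory GRing.Theory Num.Theory.
Local Open Scope ring_scope.
Set Implicit Arguments. Unset Strict Implicit. Unset Printing Implicit Defensive.


(** Put y = x - 2 = s + 1/s and F(s) = s^3 - s^2 - s - 1. Up to the factor
    s^2 - s^(-2), the polynomial q_k is s^(2k+1) F(s) - s^(-2k-1) F(1/s).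

    Apart from d, all roots of q_k satisfy -2 <= y <= 2, because y q_k(y) is an
    orthogonal polynomial (a tridiagonal determinant). At a root,
    c(y) = F(s) F(1/s) = 4 + 4y - y^3 is a unit, and (2 + y)/c(y) and
    (2 - y)(y + 1)^2/c(y) are algebraic integers with sum 1; if all conjugates
    of y lie in [-2, 2], their product has all conjugates in [0, 1/4], hence
    vanishes, and y = -1. So every root of q_k is a conjugate of d or y = -1.

    Let p >= 5 be a prime dividing q_k(y = -2) = 2k + 3 or q_k(y = 2) = -(2k + 1)
    (one of the two is prime to 3). Then y = -2, resp. y = 2, is a simple root
    mod p of the minimal polynomial of d, so p has an unramified prime of degree
    one in Q(d). If Q(d) is Galois, p splits completely and all roots of q_k
    mod p lie in F_p. There s^p = s or s^p = 1/s, which makes the roots of q_k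
    roots of two polynomials of much smaller degree, while a differential
    equation for q_k shows that almost all roots are simple: a contradiction. *)

(** * The recurrence and its degrees *)

Fixpoint lrec (R : comNzRingType) (m u v : R) (n : nat) : R :=
  if n is n'.+1 then lrec m v (m * v - u) n' else u.

Lemma lrecSS (R : comNzRingType) (m u v : R) n :
  lrec m u v n.+2 = m * lrec m u v n.+1 - lrec m u v n.
Proof. by elim: n u v => //= n IHn u v; rewrite -IHn. Qed.

Lemma rmorph_lrec (R S : comNzRingType) (f : {rmorphism R -> S}) m u v n :
  f (lrec m u v n) = lrec (f m) (f u) (f v) n.
Proof. by elim: n u v => //= n IHn u v; rewrite IHn rmorphB rmorphM. Qed.

(* q_k(x) = hseq (x - 2) k.+1; the index 0 extends the recurrence one step back. *)
Definition hseq (R : comNzRingType) (y : R) (n : nat) : R :=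
  lrec (y ^+ 2 - 2) 1 (y ^+ 2 - y - 3) n.

(* The term of index - n of the two-sided sequence extending hseq. *)
Definition hneg (R : comNzRingType) (y : R) (n : nat) : R :=
  lrec (y ^+ 2 - 2) 1 (y + 1) n.

Lemma hseqSS (R : comNzRingType) (y : R) n :
  hseq y n.+2 = (y ^+ 2 - 2) * hseq y n.+1 - hseq y n.
Proof. exact: lrecSS. Qed.

Lemma hnegSS (R : comNzRingType) (y : R) n :
  hneg y n.+2 = (y ^+ 2 - 2) * hneg y n.+1 - hneg y n.
Proof. exact: lrecSS. Qed.

Lemma nat_ind2 (P : nat -> Prop) :
  P 0%N -> P 1%N -> (forall n, P n -> P n.+1 -> P n.+2) -> forall n, P n.
Proof.
move=> P0 P1 PSS n; suff [] : P n /\ P n.+1 by [].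
by elim: n => // n [? ?]; split=> //; apply: PSS.
Qed.

Lemma rmorph_hseq (R S : comNzRingType) (f : {rmorphism R -> S}) y n :
  f (hseq y n) = hseq (f y) n.
Proof.
by rewrite /hseq rmorph_lrec; congr (lrec _ _ _ _); ring.
Qed.

Lemma rmorph_hneg (R S : comNzRingType) (f : {rmorphism R -> S}) y n :
  f (hneg y n) = hneg (f y) n.
Proof.
by rewrite /hneg rmorph_lrec; congr (lrec _ _ _ _); ring.
Qed.

Lemma q_hseq k : q k = hseq ('X - 2) k.+1.
Proof.
suff: qpair k = (hseq ('X - 2) k.+1, hseq ('X - 2) k.+2) by rewrite /q => ->.
elim: k => [|k IHk] /=.
  by rewrite /hseq /= /q0 /q1 /qmul; congr (_, _); rewrite !polyC_natr; ring.
rewrite IHk (hseqSS _ k.+1) /qmul; congr pair; congr (_ * _ - _); rewrite !polyC_natr; ring.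
Qed.

(** One step of the recurrence has determinant 1 and the initial term is 1. At a root of [hseq y n]
    the cofactor [b] inverts [hseq y n.+1]. *)
Lemma hseq_bezout (R : comNzRingType) (y : R) n :
  exists a b : R, a * hseq y n + b * hseq y n.+1 = 1.
Proof.
elim: n => [|n [a [b H]]]; first by exists 1, 0; rewrite mul0r addr0 mul1r.
by exists (b + (y ^+ 2 - 2) * a), (- a); rewrite hseqSS -[RHS]H; ring.
Qed.

(** The recurrence preserves the form u^2 - (y^2 - 2) u v + v^2. At a root of [hseq y n] this makes
    4 + 4y - y^3 the square of [hseq y n.+1]. *)
Lemma hseq_invariant (R : comNzRingType) (y : R) n :
  hseq y n.+1 ^+ 2 - (y ^+ 2 - 2) * hseq y n.+1 * hseq y n + hseq y n ^+ 2
    = 4 + 4 * y - y ^+ 3.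
Proof.
elim: n => [|n IHn]; first by rewrite /hseq /=; ring.
by rewrite -IHn hseqSS; ring.
Qed.

Lemma lrec_monic (R : comNzRingType) (m u v : {poly R}) n :
    m \is monic -> size m = 3%N -> u \is monic -> v \is monic ->
    (size u < size v)%N ->
  lrec m u v n \is monic /\ size (lrec m u v n.+1) = (size v + n.*2)%N.
Proof.
move=> mm sm; elim: n u v => [|n IHn] u v um vm suv; first by rewrite addn0.
have smv: size (m * v) = (size v).+2.
  by rewrite size_Mmonic ?monic_neq0 // sm.
have suv2: (size (- u)%R < size (m * v)%R)%N by rewrite size_polyN smv; exact: leqW (leqW suv).
have sw: size (m * v - u) = (size v).+2 by rewrite size_polyDl.
have wm: m * v - u \is monic.
  by rewrite monicE lead_coefDl // -monicE monicMr.
have [Hm Hs] := IHn v (m * v - u) vm wm ltac:(by rewrite sw; exact: leqW (leqnn _)).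
by split=> //; rewrite -[LHS]/(size (lrec m v (m * v - u) n.+1)) Hs sw doubleS !addnS !addSn.
Qed.

Lemma size_natr_le1 (R : nzRingType) n : (size (n%:R : {poly R})%R <= 1)%N.
Proof. by rewrite -polyC_natr size_polyC_leq1. Qed.

Lemma XsubC_deg2 (R : comNzRingType) (c : R) (u : {poly R}) :
  (size u <= 2)%N ->
  ('X - c%:P) ^+ 2 + u \is monic /\ size (('X - c%:P) ^+ 2 + u) = 3%N.
Proof.
move=> su; have s2 : (size u < size (('X - c%:P) ^+ 2)%R)%N.
  by rewrite size_exp_XsubC.
rewrite size_polyDl // size_exp_XsubC monicE lead_coefDl // -monicE.
by rewrite monic_exp ?monicXsubC.
Qed.

Lemma hseq_size (R : comNzRingType) (c : R) n :
  hseq ('X - c%:P) n \is monic /\ size (hseq ('X - c%:P) n) = n.*2.+1.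
Proof.
have [mm sm] := @XsubC_deg2 R c (- 2)
  ltac:(rewrite size_polyN; exact: leq_trans (size_natr_le1 _ _) _).
have [vm sv] := @XsubC_deg2 R c (- ('X - c%:P) - 3) ltac:(
  rewrite (leq_trans (size_polyD _ _)) // geq_max !size_polyN size_XsubC /=;
  exact: leq_trans (size_natr_le1 _ _) _).
rewrite addrA in vm sv; have H j := lrec_monic j mm sm (monic1 _) vm.
split; first by apply: (H n _).1; rewrite sv size_poly1.
case: n => [|n]; first by rewrite /hseq /= size_poly1.
by rewrite (H n _).2 sv ?size_poly1 //; lia.
Qed.

Lemma hneg_size (R : comNzRingType) (c : R) n :
  hneg ('X - c%:P) n \is monic /\ (size (hneg ('X - c%:P) n.+1) = n.+1.*2)%N.
Proof.
have [mm sm] := @XsubC_deg2 R c (- 2)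
  ltac:(rewrite size_polyN; exact: leq_trans (size_natr_le1 _ _) _).
have -> : hneg ('X - c%:P) = lrec (('X - c%:P) ^+ 2 - 2) 1 ('X - (c - 1)%:P).
  by rewrite polyCB polyC1 opprB addrCA addrC.
have [] := lrec_monic n mm sm (monic1 _) (monicXsubC (c - 1)).
  by rewrite size_XsubC size_poly1.
by move=> -> ->; rewrite size_XsubC; split=> //; lia.
Qed.

(** * Location of the roots *)

(* The Jacobi chain behind y * hseq y n, shifted by one: the chain itself starts
   with the constant 1, which becomes the 2 in sturm_kernel. *)
Definition sturm (R : comNzRingType) (y : R) (n : nat) : R :=
  lrec y y (y ^+ 2 - y - 2) n.

Lemma sturmSS (R : comNzRingType) (y : R) n :
  sturm y n.+2 = y * sturm y n.+1 - sturm y n.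
Proof. exact: lrecSS. Qed.

(** Every second term of a recurrence with multiplier y satisfies one with multiplier y^2 - 2. *)
Lemma hseq_sturm (R : comNzRingType) (y : R) n : y * hseq y n = sturm y n.*2.
Proof.
elim/nat_ind2: n => [||n IH0 IH1]; first by rewrite /hseq /sturm /= mulr1.
  by rewrite /hseq /sturm /=; ring.
by rewrite hseqSS mulrBr mulrCA {}IH0 {}IH1 !doubleS !sturmSS; ring.
Qed.

(* Christoffel-Darboux; the norms of the chain are 1, 2, 2, ... *)
Lemma sturm_kernel (R : comNzRingType) (x y : R) n :
  (x - y) * (2 + \sum_(i < n.+1) sturm x i * sturm y i)
    = sturm x n.+1 * sturm y n - sturm x n * sturm y n.+1.
Proof.
elim: n => [|n IHn]; first by rewrite big_ord1 /sturm /=; ring.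
by rewrite big_ord_recr /= addrA mulrDr {}IHn !sturmSS; ring.
Qed.

Lemma hseq_at2 (R : comNzRingType) n : hseq (2 : R) n = 1 - 2 * n%:R.
Proof.
elim/nat_ind2: n => [||n IH0 IH1]; [by rewrite /hseq /=; ring..|].
by rewrite hseqSS IH0 IH1 -!natr1; ring.
Qed.

Lemma hseq_atN2 (R : comNzRingType) n : hseq (- 2 : R) n = 1 + 2 * n%:R.
Proof.
elim/nat_ind2: n => [||n IH0 IH1]; [by rewrite /hseq /=; ring..|].
by rewrite hseqSS IH0 IH1 -!natr1; ring.
Qed.

(** At y and its conjugate the right side of [sturm_kernel] vanishes, while the kernel is 2 plus a
    sum of squared norms; so y is its own conjugate. *)
Lemma hseq_root_real (y : algC) n : hseq y n = 0 -> y \is Num.real.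
Proof.
case: n => [|n] yn0; first by move/eqP: yn0; rewrite oner_eq0.
have s0: sturm y n.+1.*2 = 0 by rewrite -hseq_sturm yn0 mulr0.
have sJ i : sturm y^* i = (sturm y i)^*.
  by rewrite /sturm rmorph_lrec; congr (lrec _ _ _ _); ring.
have := sturm_kernel y^* y n.*2.+1; rewrite -doubleS s0 sJ s0 rmorph0 mul0r mulr0 subr0.
move/eqP; rewrite mulf_eq0 subr_eq0 => /orP[/eqP/CrealP // | /eqP E].
suff: 0 < 2 + \sum_(i < n.*2.+2) sturm y^* i * sturm y i by rewrite E ltxx.
rewrite ltr_pwDl ?ltr0n // sumr_ge0 // => i _.
by rewrite sJ mulrC mul_conjC_ge0.
Qed.

(** For y > 2, once a positive term is followed by a nonpositive one, the sequence decreases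
    strictly from there on and cannot be 0 at a later index. *)
Lemma sturm_gt0 (y : algC) n i :
  2 < y -> sturm y n = 0 -> (i < n)%N -> 0 < sturm y i.
Proof.
move=> y2 sn0; have y0: 0 < y by apply: lt_trans y2; rewrite ltr0n.
have yr : y \is Num.real by rewrite realE ltW.
have s0: 0 < sturm y 0 by [].
have s1: 0 < sturm y 1.
  rewrite /sturm /= (_ : _ - 2 = (y - 2) * (y + 1)); last by ring.
  by rewrite mulr_gt0 ?subr_gt0 ?addr_gt0.
have sr j : sturm y j \is Num.real.
  elim/nat_ind2: j => [||j r0 r1]; [exact: gtr0_real..|].
  by rewrite sturmSS rpredB ?rpredM.
have neg j : 0 < sturm y j -> sturm y j.+1 <= 0 ->
    forall m, sturm y (j.+1 + m) <= 0 /\ sturm y (j.+2 + m) < sturm y (j.+1 + m).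
  move=> sj0 sj1; elim=> [|m [IH0 IH1]].
    rewrite !addn0; split=> //; rewrite sturmSS -subr_lt0.
    rewrite (_ : _ - _ - _ = (y - 1) * sturm y j.+1 - sturm y j); last by ring.
    rewrite subr_lt0 (le_lt_trans _ sj0) // mulr_ge0_le0 // subr_ge0.
    by apply: ltW; apply: lt_trans y2; rewrite ltr1n.
  have IH2 : sturm y (j.+2 + m) <= 0 by apply: ltW; apply: lt_le_trans IH1 _.
  rewrite !addnS !addSn in IH0 IH1 IH2 *; split=> //; rewrite sturmSS -subr_lt0.
  set a := sturm y (j + m).+1 in IH0 IH1 *; set b := sturm y (j + m).+2 in IH1 IH2 *.
  rewrite (_ : _ - _ - _ = (y - 2) * b + (b - a)); last by ring.
  by rewrite ltr_wnDl ?subr_lt0 // mulr_ge0_le0 // subr_ge0 ltW.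
elim: i => // i IHi ltin; have si := IHi (ltnW ltin).
have [//|sle] := real_ltP (real0 _) (sr i.+1).
have [le0] := neg i si sle (n - i.+2)%N; rewrite subnKC // sn0.
by move=> lt0; have := lt_le_trans lt0 le0; rewrite ltxx.
Qed.
(** By [sturm_gt0] the kernel of [sturm_kernel] is positive at (x, y), while the right side
    vanishes. *)
Lemma hseq_root_gt2_unique (x y : algC) n :
  2 < x -> 2 < y -> hseq x n = 0 -> hseq y n = 0 -> x = y.
Proof.
case: n => [|n] x2 y2 xn0 yn0; first by move/eqP: xn0; rewrite oner_eq0.
have sx0: sturm x n.+1.*2 = 0 by rewrite -hseq_sturm xn0 mulr0.
have sy0: sturm y n.+1.*2 = 0 by rewrite -hseq_sturm yn0 mulr0.
have := sturm_kernel x y n.*2.+1; rewrite -doubleS sx0 sy0 mul0r mulr0 subr0.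
move/eqP; rewrite mulf_eq0 subr_eq0 => /orP[/eqP // | /eqP E].
suff: 0 < 2 + \sum_(i < n.*2.+2) sturm x i * sturm y i by rewrite E ltxx.
rewrite ltr_pwDl ?ltr0n // sumr_ge0 // => i _.
by rewrite mulr_ge0 // ltW //; apply: sturm_gt0 (ltn_ord i).
Qed.

Lemma hseq_gt0 (y : algC) n : y < - 2 -> 0 < hseq y n.
Proof.
move=> y2; have t0: 0 < - 2 - y by rewrite subr_gt0.
pose t := - 2 - y; have Dy: y = - 2 - t by rewrite /t; ring.
suff [] : 0 < hseq y n /\ hseq y n < hseq y n.+1 by [].
elim: n => [|n [IH0 IH1]].
  split; first by rewrite ltr01.
  rewrite /hseq /= -subr_gt0 (_ : _ - 1 = t ^+ 2 + 5 * t + 2).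
    by rewrite !addr_gt0 ?exprn_gt0 ?mulr_gt0 ?ltr0n.
  by rewrite Dy; ring.
have IH2 := lt_trans IH0 IH1; split=> //.
rewrite hseqSS -subr_gt0 (_ : _ - _ - _ = (t ^+ 2 + 4 * t) * hseq y n.+1 +
   (hseq y n.+1 - hseq y n)); last by rewrite Dy; ring.
by rewrite addr_gt0 ?subr_gt0 // mulr_gt0 // addr_gt0 ?exprn_gt0 ?mulr_gt0 ?ltr0n.
Qed.

Lemma algC_roots (p : {poly algC}) : p \is monic ->
  exists rs : seq algC, p = \prod_(r <- rs) ('X - r%:P).
Proof.
move=> pm; have [rs Hrs] := closed_field_poly_normal p.
by exists rs; rewrite {1}Hrs (monicP pm) scale1r.
Qed.

(** If all roots were at most 2, the value at 2 would be a product of factors 2 - r >= 0; but it is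
    1 - 2n < 0. *)
Lemma hseq_root_gt2_exists n :
  (0 < n)%N -> exists2 y : algC, 2 < y & hseq y n = 0.
Proof.
move=> n0; have [pm _] := @hseq_size algC 0 n.
have [rs Drs] := algC_roots pm.
have ev (y : algC) : (hseq ('X - 0%:P) n).[y] = hseq y n.
  by rewrite -[_.[y]]/(horner_eval y _) rmorph_hseq rmorphB /= /horner_eval !hornerE subr0.
have rt r : r \in rs -> hseq r n = 0.
  by move=> rrs; rewrite -ev Drs; apply/eqP; rewrite -/(root _ _) root_prod_XsubC.
case: (boolP (has (fun r : algC => 2 < r) rs)) => [/hasP[r rrs r2]|].
  by exists r; rewrite ?rt.
move/hasPn => le2.
suff: 0 <= hseq (2 : algC) n.
  by rewrite hseq_at2 subr_ge0 -natrM lern1; case: n n0 {pm Drs ev rt} => // n _; lia.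
rewrite -ev Drs horner_prod big_seq prodr_ge0 // => r rrs.
rewrite !hornerE subr_ge0 real_leNgt ?le2 //.
exact: hseq_root_real (rt _ rrs).
Qed.

Lemma hseq_roots_location (d y : algC) n : (0 < n)%N -> d \is Num.real ->
    hseq d n = 0 -> (forall z, z \is Num.real -> hseq z n = 0 -> z <= d) ->
  hseq y n = 0 -> y = d \/ -2 <= y <= 2.
Proof.
move=> n0 dr dn0 dmax yn0; have yr := hseq_root_real yn0.
have [z z2 zn0] := hseq_root_gt2_exists n0.
have d2: 2 < d by apply: lt_le_trans z2 (dmax _ (hseq_root_real zn0) zn0).
have r2 : (2 : algC) \is Num.real by exact: realn.
have [yle|ygt] := real_leP yr r2; last by left; apply: hseq_root_gt2_unique dn0.
right; rewrite andbT real_leNgt ?realN //; apply/negP => /(@hseq_gt0 _ n).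
by rewrite yn0 ltxx.
Qed.

(** * Conjugates of algebraic integers *)

Local Notation pZC := (map_poly (intr : int -> algC)).

Definition evC (r : algC) : {rmorphism {poly int} -> algC} := horner_eval r \o pZC.

Lemma evCE r p : evC r p = (pZC p).[r].
Proof. by []. Qed.

Lemma evC_rootE r p : root (pZC p) r = (evC r p == 0).
Proof. by []. Qed.

Lemma evC_X r : evC r 'X = r.
Proof. by rewrite evCE map_polyX hornerX. Qed.

Lemma evC_hseq r n : evC r (hseq ('X - 2) n) = hseq (r - 2) n.
Proof. by rewrite rmorph_hseq; congr hseq; rewrite rmorphB evC_X; congr (_ - _); ring. Qed.

Lemma evC_aint r p : r \in Aint -> evC r p \in Aint.
Proof.
move=> rA; rewrite evCE; apply: rpred_horner => //.
by apply/polyOverP => i; rewrite coef_map Aint_int.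
Qed.

(** The minimal polynomial over Z. Divisibility is asked in Z[X], so that quotients can be evaluated
    at integers modulo p. *)
Definition is_minZ (x : algC) (m : {poly int}) : Prop :=
  [/\ m \is monic, evC x m = 0 &
      forall f, evC x f = 0 -> exists h, f = h * m].

Lemma minZ_exists x : x \in Aint -> exists m, is_minZ x m.
Proof.
move=> xA; have /floorpP[m Dm] := xA.
have [P [DP Pm Pmin]] := minCpolyP x.
have mm : m \is monic.
  have := minCpoly_monic x; rewrite Dm !monicE lead_coef_map_inj //; last exact: intr_inj.
  by rewrite -[1]/(1%:~R) eqr_int.
have DmP : P = map_poly intr m.
  apply: (@map_poly_inj _ _ (ratr : {rmorphism rat -> algC})).
  rewrite -DP Dm -map_poly_comp; apply: eq_map_poly => i /=.
  by rewrite ratr_int.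
exists m; split=> // [|f f0].
  by rewrite evCE -Dm; apply/rootP; exact: root_minCpoly.
exists (Pdiv.Ring.rdivp f m).
have Df := Pdiv.RingMonic.rdivp_eq mm f.
suff E : Pdiv.Ring.rmodp f m = 0; first by rewrite {1}Df E addr0.
set R := Pdiv.Ring.rmodp f m in Df *.
have sR : (size R < size m)%N by rewrite Pdiv.Ring.ltn_rmodpN0 // monic_neq0.
have R0 : evC x R = 0.
  have := congr1 (evC x) Df; rewrite f0 rmorphD rmorphM [evC x m]evCE -Dm.
  by rewrite (rootP (root_minCpoly x)) mulr0 add0r => <-.
have : P %| map_poly intr R.
  rewrite -Pmin -map_poly_comp; apply/rootP; rewrite -[RHS]R0 evCE; congr _.[x].
  by apply: eq_map_poly => i /=; rewrite ratr_int.
apply: contraTeq => Rn0; rewrite DmP.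
have in0 : map_poly (intr : int -> rat) R != 0.
  by rewrite map_poly_eq0_id0 // intr_eq0 lead_coef_eq0.
apply/negP => /(dvdp_leq in0).
by rewrite !(size_map_inj_poly (@intr_inj rat)) ?mulr0z // leqNgt sR.
Qed.

(** Irreducibility of [m]: let m' be minimal for y and m = h m'. Either m' kills x, and m and m'
    divide each other, or h does, and m' would be constant. *)
Lemma minZ_root x y m : x \in Aint -> is_minZ x m -> evC y m = 0 -> is_minZ y m.
Proof.
move=> xA [mm mx mmin] my; have yA : y \in Aint.
  apply: (@root_monic_Aint (pZC m)); rewrite ?evC_rootE ?my ?monic_map //.
  by apply/polyOverP => i; rewrite coef_map intr_int.
have [m' [m'm m'y m'min]] := minZ_exists yA.
have [h Dh] := m'min m my.
have [m'x|m'x] := eqVneq (evC x m') 0; last first.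
  have [k Dk] : exists k, h = k * m.
    apply: mmin; move/eqP: mx; rewrite Dh rmorphM mulf_eq0 (negPf m'x) orbF.
    by move/eqP.
  have /(mulIf (monic_neq0 mm)) E : 1 * m = (k * m') * m by rewrite mul1r {1}Dh Dk; ring.
  have kn : k != 0 by apply: contra_eq_neq E => ->; rewrite mul0r oner_eq0.
  have := size_mul kn (monic_neq0 m'm); rewrite -E size_poly1.
  have := kn; have := monic_neq0 m'm; rewrite -!size_poly_gt0 => p1 p2 sz.
  have s1 : size m' = 1%N by move: p1 p2 sz; case: (size k) => // a; case: (size m') => // c; lia.
  move/eqP/size_poly1P: s1 m'y => [c c0 ->].
  by rewrite evCE map_polyC hornerC => /eqP; rewrite intr_eq0 (negPf c0).
have [k Dk] := mmin m' m'x.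
suff -> : m = m' by [].
have /(mulIf (monic_neq0 mm)) E : 1 * m = (h * k) * m by rewrite mul1r {1}Dh Dk; ring.
have hn : h != 0 by apply: contra_eq_neq E => ->; rewrite mul0r oner_eq0.
have kn : k != 0 by apply: contra_eq_neq E => ->; rewrite mulr0 oner_eq0.
have := size_mul hn kn; rewrite -E size_poly1.
have := kn; have := hn; rewrite -!size_poly_gt0 => p1 p2 sz.
have /eqP/size_poly1P[c c0 hc] : size h = 1%N by move: p1 p2 sz; case: (size k) => // a; case: (size h) => // b; lia.
have := monicP mm; rewrite Dh hc mul_polyC lead_coefZ (monicP m'm) mulr1 => ->.
by rewrite scale1r.
Qed.

(* L is the remainder of P' f modulo P := prod (X - r): by Lagrange interpolation it
   is the sum of the f(r) P / (X - r), whose leading term collects the f(r). *)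
Lemma sum_roots_lagrange (F : fieldType) (f : {poly F}) (rs : seq F) :
  exists L k : {poly F},
    [/\ (\prod_(r <- rs) ('X - r%:P))^`() * f
          = L + k * \prod_(r <- rs) ('X - r%:P),
        (size L <= size rs)%N & L`_(size rs).-1 = \sum_(r <- rs) f.[r]].
Proof.
elim: rs => [|r rs [L [k [H sL cL]]]].
  by exists 0, 0; rewrite !big_nil derivC mul0r mul0r addr0 size_poly0 coef0.
rewrite !big_cons; set P := \prod_(r <- rs) _ in H *.
have sP: size P = (size rs).+1 by rewrite size_prod_XsubC.
have [kr Dk] : exists kr, f - f.[r]%:P = kr * ('X - r%:P).
  by apply/factor_theorem; rewrite /root !hornerE subrr.
exists (f.[r]%:P * P + ('X - r%:P) * L), (kr + k); split.
- rewrite derivM derivXsubC mul1r mulrDl -mulrA H -[f in P * f](subrK f.[r]%:P) Dk; ring.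
- rewrite (leq_trans (size_polyD _ _)) // geq_max; apply/andP; split.
    by rewrite mul_polyC (leq_trans (size_scale_leq _ _)) ?sP.
  rewrite (leq_trans (size_polyMleq _ _)) // size_XsubC; exact: sL.
rewrite /= coefD mulrBl coefB coefXM !coefCM.
have -> : P`_(size rs) = 1.
  by have := monic_prod_XsubC rs xpredT id; rewrite monicE lead_coefE sP /= => /eqP.
rewrite [L`_(size rs)]nth_default // mulr0 subr0 mulr1; congr (_ + _).
by case: (size rs) sL cL => [|n] //=; rewrite leqn0 size_poly_eq0 => /eqP->; rewrite coef0 => <-.
Qed.

(** The sum is a coefficient of the remainder of m' f modulo m, which is integral because m is
    monic. *)
Lemma sum_roots_int (m f : {poly int}) (rs : seq algC) :
  m \is monic -> pZC m = \prod_(r <- rs) ('X - r%:P) ->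
  \sum_(r <- rs) evC r f \in Num.int.
Proof.
move=> mm Dm; have [L [k []]] := sum_roots_lagrange (pZC f) rs.
rewrite -Dm => H sL cL; rewrite -cL.
have sm : size (pZC m) = (size rs).+1 by rewrite Dm size_prod_XsubC.
suff -> : L = pZC (Pdiv.Ring.rmodp (m^`() * f) m) by rewrite coef_map /= intr_int.
have Df := Pdiv.RingMonic.rdivp_eq mm (m^`() * f).
set R := Pdiv.Ring.rmodp _ _ in Df *; set Q := Pdiv.Ring.rdivp _ _ in Df *.
have sR : (size R < size m)%N by rewrite Pdiv.Ring.ltn_rmodpN0 // monic_neq0.
move: H; rewrite deriv_map -rmorphM /= Df rmorphD rmorphM /=.
move=> H; have : pZC m %| L - pZC R.
  rewrite (_ : L - _ = (pZC Q - k) * pZC m); first exact: dvdp_mulIr.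
  by rewrite -[L](addrK (k * pZC m)) -H; ring.
apply: contraTeq; rewrite -subr_eq0 => n0; apply/negP => /(dvdp_leq n0).
rewrite sm leqNgt ltnS (leq_trans (size_polyD _ _)) // geq_max sL size_polyN /=.
by rewrite (size_map_inj_poly (@intr_inj algC)) ?mulr0z // -ltnS -sm (size_map_inj_poly (@intr_inj algC)) ?mulr0z.
Qed.

(** With n roots, the sum of the f(r)^(n+1) is a nonnegative integer and at most n / 4^(n+1) < 1, so
    every summand vanishes. *)
Lemma conj_small_eq0 (m f : {poly int}) (rs : seq algC) :
    m \is monic -> pZC m = \prod_(r <- rs) ('X - r%:P) ->
    (forall r, r \in rs -> 0 <= evC r f <= 4^-1) ->
  forall r, r \in rs -> evC r f = 0.
Proof.
move=> mm Dm bnd; set n := size rs.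
have Sint := sum_roots_int (f ^+ n.+1) mm Dm.
have pos r : r \in rs -> 0 <= evC r (f ^+ n.+1).
  by move=> /bnd/andP[f0 _]; rewrite rmorphXn exprn_ge0.
have S0 : \sum_(r <- rs) evC r (f ^+ n.+1) = 0.
  apply/eqP; apply: contraTT isT => /(norm_intr_ge1 Sint).
  rewrite ger0_norm; last by rewrite big_seq sumr_ge0.
  move=> le1; have : \sum_(r <- rs) evC r (f ^+ n.+1) <= \sum_(r <- rs) (4^-1) ^+ n.+1.
    rewrite big_seq [leRHS]big_seq; apply: ler_sum => r /bnd/andP[f0 f1].
    by rewrite rmorphXn lerXn2r // nnegrE invr_ge0 ler0n.
  have -> : \sum_(r <- rs) (4^-1 : algC) ^+ n.+1 = (4^-1) ^+ n.+1 *+ n.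
    by rewrite big_const_seq count_predT iter_addr_0.
  move/(le_trans le1).
  rewrite exprVn -mulr_natl ler_pdivlMr ?exprn_gt0 ?ltr0n // mul1r -natrX ler_nat leqNgt.
  by rewrite (leq_trans (ltnSn n)) // ltnW // ltn_expl.
move=> r rrs; move/eqP: S0; rewrite big_seq psumr_eq0 //.
by move/allP/(_ r rrs); rewrite rrs implyTb rmorphXn expf_eq0 ltn0Sn => /eqP.
Qed.

(** * Roots that are not conjugate to the largest one *)

Lemma hseq_real (y : algC) n : y \is Num.real -> hseq y n \is Num.real.
Proof.
move=> yr; have y2r : y ^+ 2 \is Num.real by rewrite rpredX.
elim/nat_ind2: n => [||n r0 r1]; first exact: rpred1.
  by rewrite /hseq /= rpredB ?realn // rpredB.
by rewrite hseqSS rpredB // rpredM // rpredB ?realn.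
Qed.

(* With t = (2 - y)(y + 1)^2 b^2 and s = (2 + y) b^2 one has s + t = b^2 w^2 = 1. *)
Lemma hseq_seg_bound (y w b : algC) :
    -2 <= y <= 2 -> w \is Num.real -> b * w = 1 -> w ^+ 2 = 4 + 4 * y - y ^+ 3 ->
  0 <= (4 - y ^+ 2) * (y + 1) ^+ 2 * b ^+ 4 <= 4^-1.
Proof.
move=> /andP[y1 y2] wr bw w2.
have yp : 0 <= y + 2 by rewrite -lerBlDr sub0r.
have yr : y \is Num.real by rewrite -(addrK 2 y) rpredB ?ger0_real.
have wn0 : w != 0 by apply: contra_eq_neq bw => ->; rewrite mulr0 eq_sym oner_eq0.
have br : b \is Num.real by rewrite -[b](mulfK wn0) bw mul1r rpredV.
have yr1 : y + 1 \is Num.real by rewrite rpredD ?rpred1.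
pose s := (y + 2) * b ^+ 2; pose t := (2 - y) * ((y + 1) * b) ^+ 2.
have st : s + t = 1.
  have -> : s + t = (4 + 4 * y - y ^+ 3) * b ^+ 2 by rewrite /s /t; ring.
  by rewrite -w2 mulrC -exprMn bw expr1n.
have -> : (4 - y ^+ 2) * (y + 1) ^+ 2 * b ^+ 4 = s * t by rewrite /s /t; ring.
have s0 : 0 <= s by rewrite mulr_ge0 // real_exprn_even_ge0.
have t0 : 0 <= t by rewrite mulr_ge0 ?subr_ge0 // real_exprn_even_ge0 ?rpredM.
rewrite mulr_ge0 //= -[4^-1]mulr1 ler_pdivlMl ?ltr0n // -subr_ge0.
have : (s + t) ^+ 2 - 4 * (s * t) = (s - t) ^+ 2 by ring.
rewrite st expr1n => ->.
by rewrite real_exprn_even_ge0 // rpredB ?ger0_real.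
Qed.

(** If x is not conjugate to d, all its conjugates have y in [-2, 2], and [conj_small_eq0] forces (4
    - y^2)(y + 1)^2 = 0. The values of [hseq] at y = 2 and y = -2 are odd integers, so y = -1. *)
Lemma hseq_roots_conj (d x : algC) (m : {poly int}) n :
    (0 < n)%N -> is_minZ d m -> d \is Num.real -> hseq (d - 2) n = 0 ->
    (forall z, z \is Num.real -> hseq (z - 2) n = 0 -> z <= d) ->
  hseq (x - 2) n = 0 -> evC x m = 0 \/ x = 1.
Proof.
move=> n0 [mm md mmin] dr dn0 dmax xn0.
have xA : x \in Aint.
  have [Hm _] := @hseq_size int 2 n; rewrite polyC_natr in Hm.
  apply: (@root_monic_Aint (pZC (hseq ('X - 2) n))).
  - by rewrite evC_rootE evC_hseq xn0.
  - exact: monic_map.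
  by apply/polyOverP => i; rewrite coef_map intr_int.
have [mx [mxm mxx mxmin]] := minZ_exists xA.
have [|nx] := eqVneq (evC x m) 0; [by left | right].
have [rs Drs] : exists rs, pZC mx = \prod_(r <- rs) ('X - r%:P).
  by apply: algC_roots; exact: monic_map.
have rsE r : (r \in rs) = (evC r mx == 0).
  by rewrite -evC_rootE Drs root_prod_XsubC.
have rsd : d \notin rs.
  rewrite rsE; apply/eqP => /(minZ_root xA (And3 mxm mxx mxmin))[_ _ /(_ m md)[h Dm]].
  by case/eqP: nx; rewrite Dm rmorphM mxx mulr0.
have rsn r : r \in rs -> hseq (r - 2) n = 0.
  have /mxmin[h Dh] : evC x (hseq ('X - 2) n) = 0 by rewrite evC_hseq.
  by rewrite rsE -evC_hseq Dh rmorphM => /eqP->; rewrite mulr0.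
have [a [b Hb]] := hseq_bezout ('X - 2 : {poly int}) n.
have bw r : r \in rs -> evC r b * hseq (r - 2) n.+1 = 1.
  by move=> /rsn rn0; have := congr1 (evC r) Hb; rewrite rmorphD !rmorphM !evC_hseq rn0 mulr0 add0r rmorph1.
have loc r : r \in rs -> -2 <= r - 2 <= 2.
  move=> rrs; have := @hseq_roots_location (d - 2) (r - 2) n n0.
  case=> //; first by rewrite rpredB ?realn //.
  - move=> z zr zn; rewrite lerBrDr dmax ?addrK // (rpredD zr) ?realn //.
  - exact: rsn.
  by move/addIr => rd; rewrite -rd rrs in rsd.
(* The product of the two algebraic integers of sum 1; writing [b ^+ 2] for 1/c(y) makes it a
   polynomial over Z. *)
pose f : {poly int} := (4 - ('X - 2) ^+ 2) * ('X - 2 + 1) ^+ 2 * b ^+ 4.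
have fE r : evC r f = (4 - (r - 2) ^+ 2) * (r - 2 + 1) ^+ 2 * evC r b ^+ 4.
  have EX : evC r ('X - 2) = r - 2 by rewrite rmorphB evC_X; congr (_ - _); ring.
  by rewrite /f -EX; ring.
have fb r : r \in rs -> 0 <= evC r f <= 4^-1.
  move=> rrs; rewrite fE; apply: hseq_seg_bound (loc _ rrs) _ (bw _ rrs) _.
    exact: hseq_real (hseq_root_real (rsn r rrs)).
  by rewrite -(hseq_invariant _ n) rsn //; ring.
have xrs : x \in rs by rewrite rsE mxx.
have := conj_small_eq0 mxm Drs fb xrs; rewrite fE => /eqP.
rewrite 2!mulf_eq0 !expf_eq0 /= -orbA => /or3P[| |]; last first.
- by move=> /eqP b0; have /eqP := bw _ xrs; rewrite [evC x b]b0 mul0r eq_sym oner_eq0.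
- by rewrite (_ : x - 2 + 1 = x - 1) ?subr_eq0 => [/eqP //|]; ring.
rewrite (_ : 4 - _ = (2 - (x - 2)) * (2 + (x - 2))); last by ring.
have hx := rsn _ xrs.
rewrite mulf_eq0 subr_eq0 [2 + _]addrC addr_eq0 => /orP[/eqP E|/eqP E]; move/eqP: hx.
  by rewrite -E hseq_at2 subr_eq0 -natrM (eqr_nat _ 1); lia.
by rewrite E hseq_atN2 -natrM -(natrD _ 1) pnatr_eq0.
Qed.
(** * Complete splitting in the Galois case *)

(* Pitfall: Adiv 0 x always holds, since x / 0 = 0. *)
Definition Adiv (e : nat) (x : algC) : Prop := x / e%:R \in Aint.

Lemma AdivD e x y : Adiv e x -> Adiv e y -> Adiv e (x + y).
Proof. by move=> ? ?; rewrite /Adiv mulrDl rpredD. Qed.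

Lemma AdivN e x : Adiv e x -> Adiv e (- x).
Proof. by move=> ?; rewrite /Adiv mulNr rpredN. Qed.

Lemma AdivM e x y : x \in Aint -> Adiv e y -> Adiv e (x * y).
Proof. by move=> ? ?; rewrite /Adiv -mulrA rpredM. Qed.

Lemma Adiv_int e z : (0 < e)%N -> Adiv e z%:~R -> (e %| z)%Z.
Proof.
move=> e0 H; have en : (e%:R : algC) != 0 by rewrite pnatr_eq0 -lt0n.
have /intrP[k Dk] : (z%:~R / e%:R : algC) \in Num.int.
  by apply: Cint_rat_Aint H; rewrite rpred_div ?rpred_int ?rpred_nat.
apply/dvdzP; exists k; apply: (@intr_inj algC).
by rewrite rmorphM /= -Dk mulfVK.
Qed.

Lemma dvdz_Adiv (e : nat) (z : int) x :
  (0 < e)%N -> (e %| z)%Z -> x \in Aint -> Adiv e (z%:~R * x).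
Proof.
move=> e0 /dvdzP[k ->] xA; rewrite /Adiv rmorphM /= mulrAC mulfK.
  by rewrite rpredM ?Aint_int.
by rewrite pnatr_eq0 -lt0n.
Qed.

Lemma Adiv_coprime (p : nat) (z : int) x :
  prime p -> ~~ (p %| z)%Z -> x \in Aint -> Adiv p (z%:~R * x) -> Adiv p x.
Proof.
move=> pp pz xA H; have cop : coprimez p z by rewrite coprimezE /= prime_coprime.
have [u [v Huv]] := Bezoutz p z; rewrite (eqP cop) in Huv.
have -> : x = (u * p)%:~R * x + v%:~R * (z%:~R * x).
  by rewrite mulrA -!rmorphM -mulrDl -rmorphD /= Huv mul1r.
apply: AdivD; last by apply: AdivM H; exact: Aint_int.
by apply: dvdz_Adiv; rewrite ?prime_gt0 ?dvdz_mull.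
Qed.

(* G is the homogenization p^n f(E/p); as f is monic, G = E^n mod p. *)
Lemma homogenize (f E : {poly int}) (p : nat) : f \is monic ->
  exists G k : {poly int}, G = E ^+ (size f).-1 + p%:R * k /\
    forall r t, p%:R * t = evC r E -> evC r G = p%:R ^+ (size f).-1 * evC t f.
Proof.
move=> fm; set n := (size f).-1; have sf : size f = n.+1.
  by rewrite prednK // size_poly_gt0 monic_neq0.
exists (\sum_(i < n.+1) (f`_i * p%:R ^+ (n - i))%:P * E ^+ i).
exists (\sum_(i < n) (f`_i * p%:R ^+ (n - i).-1)%:P * E ^+ i); split.
  rewrite big_ord_recr /= subnn expr0 mulr1 addrC.
  have -> : f`_n = 1 by have := monicP fm; rewrite lead_coefE sf.
  rewrite mul1r mulr_sumr; congr (_ + _); apply: eq_bigr => i _.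
  rewrite mulrA -polyC_natr -polyCM mulrCA -exprS prednK // subn_gt0; exact: ltn_ord.
move=> r t Ht; rewrite rmorph_sum [evC t f]evCE horner_coef.
rewrite (size_map_inj_poly (@intr_inj algC)) ?mulr0z // sf mulr_sumr.
apply: eq_bigr => i _; rewrite rmorphM rmorphXn -Ht coef_map exprMn.
rewrite evCE map_polyC hornerC /= rmorphM rmorphXn /=.
have -> : (p%:R : algC) ^+ n = p%:R ^+ (n - i) * p%:R ^+ i.
  by rewrite -exprD subnK // -ltnS ltn_ord.
by rewrite rmorph_nat; ring.
Qed.

(** The homogenized minimal polynomial of E(x)/p vanishes at x, so it is a multiple of [m] and
    vanishes at y: E(y)/p is a root of the same monic polynomial. *)
Lemma Adiv_conj x y m (E : {poly int}) p : x \in Aint -> (0 < p)%N ->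
  is_minZ x m -> evC y m = 0 -> Adiv p (evC x E) -> Adiv p (evC y E).
Proof.
move=> xA p0 [_ _ mmin] my xE; have [f [fm fx _]] := minZ_exists xE.
have pn : (p%:R : algC) != 0 by rewrite pnatr_eq0 -lt0n.
have [G [k [_ HG]]] := homogenize E p fm.
have divK z : p%:R * (z / p%:R) = z :> algC by rewrite mulrC mulfVK.
have [h Dh] : exists h, G = h * m by apply: mmin; rewrite (HG _ _ (divK _)) fx mulr0.
have /eqP := HG y _ (divK _); rewrite Dh rmorphM my mulr0 eq_sym mulf_eq0 expf_eq0.
rewrite (negPf pn) andbF /= => /eqP f0.
apply: (@root_monic_Aint (pZC f)); [exact/eqP | exact: monic_map|].
by apply/polyOverP => i; rewrite coef_map intr_int.
Qed.

(** * Hensel lifting *)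

Lemma taylor1 (g : {poly int}) (c h : int) :
  exists k, g.[c + h] = g.[c] + g^`().[c] * h + k * (h * h).
Proof.
elim/poly_ind: g => [|g a [k IH]]; first by exists 0; rewrite deriv0 !horner0; ring.
exists (g^`().[c] + k * (c + h)); rewrite derivD derivM derivX derivC.
by rewrite !(hornerD, hornerM, hornerX, hornerC) IH; ring.
Qed.

Lemma horner_subC (R : comNzRingType) (g : {poly R}) (c : R) :
  exists e, g - (g.[c])%:P = e * ('X - c%:P).
Proof. by apply/factor_theorem; rewrite /root !hornerE subrr. Qed.

Lemma hensel (g : {poly int}) (p : nat) (c : int) N :
    prime p -> (p %| g.[c])%Z -> ~~ (p %| g^`().[c])%Z ->
  exists c', ((p ^ N.+1)%N %| g.[c'])%Z /\ ~~ (p %| g^`().[c'])%Z.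
Proof.
move=> pp pg pg'; elim: N => [|N [c' [/dvdzP[a Ha] Hc']]].
  by exists c; rewrite expn1.
have cop : coprimez p (g^`().[c']) by rewrite coprimezE /= prime_coprime.
have [u [v Huv]] := Bezoutz p (g^`().[c']); rewrite (eqP cop) in Huv.
set q := (p ^ N.+1)%N in Ha *; pose h := - a * v * q%:Z.
have pq : (p %| q%:Z)%Z by rewrite /q expnS PoszM dvdz_mulr.
exists (c' + h); split.
  have [k ->] := taylor1 g c' h; rewrite Ha /h.
  rewrite (_ : _ + _ = (a * u * p + k * (a * v) ^+ 2 * q%:Z) * q%:Z); last first.
    have -> : g^`().[c'] * (- a * v * q) = - a * (v * g^`().[c']) * q by ring.
    have -> : v * g^`().[c'] = 1 - u * p by rewrite -Huv; ring.
    by ring.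
  by rewrite expnS PoszM dvdz_mul // rpredD // dvdz_mull.
have [e He] := horner_subC g^`() c'.
have := congr1 (fun f => f.[c' + h]) He; rewrite !hornerE => E.
apply: contra Hc' => H.
have -> : g^`().[c'] = g^`().[c' + h] - e.[c' + h] * h.
  have -> : e.[c' + h] * h = e.[c' + h] * (c' + h - c') by ring.
  by rewrite -E; ring.
by rewrite rpredD // rpredN dvdz_mull // /h dvdz_mull.
Qed.

Lemma dvdz_prime_fermat (p : nat) (a : int) : prime p -> (p %| a ^+ p - a)%Z.
Proof.
move=> pp; rewrite (dvdz_pcharf (pchar_Fp pp)) rmorphB rmorphXn /=.
by have := expf_card (a%:~R : 'F_p); rewrite card_Fp // => ->; rewrite subrr.
Qed.

(** * A simple root modulo p and the Frobenius congruence *)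

Section Frobenius.

Variables (d : algC) (m : {poly int}) (rs : seq algC) (p : nat).
Hypotheses (pp : prime p) (dA : d \in Aint) (dm : is_minZ d m).
Hypothesis Drs : pZC m = \prod_(r <- rs) ('X - r%:P).

Let p0 : (0 < p)%N := prime_gt0 pp.

Lemma roots_minZE r : (r \in rs) = (evC r m == 0).
Proof. by rewrite -evC_rootE Drs root_prod_XsubC. Qed.

Lemma roots_minZ_Aint r : r \in rs -> r \in Aint.
Proof.
have [mm _ _] := dm; rewrite roots_minZE -evC_rootE => mr.
apply: (root_monic_Aint mr); first exact: monic_map.
by apply/polyOverP => i; rewrite coef_map intr_int.
Qed.

Section Cofactor.

Variables (c : int) (e : {poly int}).
Hypotheses (De : m - (m.[c])%:P = e * ('X - c%:P)).
Hypotheses (pm : (p %| m.[c])%Z) (pm' : ~~ (p %| m^`().[c])%Z).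

(** At a root r of [m], e(r) (r - c) = - m(c) lies in pO, while e(c) is a unit modulo p. So e(r)
    lies in every prime above p except those containing r - c. *)
Lemma cofactor_root : e.[c] = m^`().[c].
Proof.
have := congr1 (fun f : {poly int} => f^`().[c]) De.
rewrite derivB derivC subr0 derivM derivXsubC mulr1 hornerD hornerM.
by rewrite hornerXsubC subrr mulr0 add0r.
Qed.

Lemma evC_subC (g k : {poly int}) (b : int) r :
  g - (g.[b])%:P = k * ('X - b%:P) ->
  evC r g - (g.[b])%:~R = evC r k * (r - b%:~R).
Proof.
move/(congr1 (evC r)); rewrite rmorphM !rmorphB evC_X.
by rewrite ![evC r _%:P]evCE !map_polyC !hornerC.
Qed.

(* prod_r (e(c) - e(r)) lies in pO because c - r divides e(c) - e(r), while
   modulo the multiples of the e(r) it is the unit e(c)^n mod p. *)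
Lemma Adiv_cofactor x : x \in Aint ->
  (forall r, r \in rs -> Adiv p (evC r e * x)) -> Adiv p x.
Proof.
move=> xA ex; set E := e.[c]; have [k Dk] := horner_subC e c.
have kA r : r \in rs -> evC r k \in Aint by move/roots_minZ_Aint/evC_aint.
have eA r : r \in rs -> evC r e \in Aint by move/roots_minZ_Aint/evC_aint.
have mod_e (s : seq algC) : {subset s <= rs} ->
    Adiv p (\prod_(r <- s) (E%:~R - evC r e) * x - (E ^+ size s)%:~R * x).
  elim: s => [|r s IHs] sub; first by rewrite big_nil /Adiv !mul1r subrr mul0r rpred0.
  have sub' : {subset s <= rs} by move=> y ys; rewrite sub // inE ys orbT.
  have rrs : r \in rs by rewrite sub // inE eqxx.
  rewrite big_cons /= exprS rmorphM /=.
  set P := \prod_(j <- s) _ in IHs *.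
  have PA : P \in Aint.
    rewrite /P big_seq rpred_prod // => j js.
    by rewrite rpredB ?Aint_int ?eA ?sub'.
  have -> : (E%:~R - evC r e) * P * x - E%:~R * (E ^+ size s)%:~R * x
      = E%:~R * (P * x - (E ^+ size s)%:~R * x) - P * (evC r e * x) by ring.
  apply: AdivD; first by apply: AdivM (IHs sub'); exact: Aint_int.
  by apply: AdivN; apply: AdivM => //; exact: ex.
have prodE : \prod_(r <- rs) (E%:~R - evC r e)
    = (m.[c])%:~R * \prod_(r <- rs) evC r k.
  have -> : (m.[c])%:~R = \prod_(r <- rs) (c%:~R - r) :> algC.
    rewrite -[LHS]/(intr _) -horner_map /= Drs horner_prod.
    by apply: eq_bigr => r _; rewrite hornerXsubC.
  rewrite -big_split; apply: eq_bigr => r _ /=.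
  by rewrite -[LHS]opprB (evC_subC r Dk); ring.
have := mod_e rs (fun _ => id); rewrite prodE => H.
have : Adiv p ((E ^+ size rs)%:~R * x).
  rewrite (_ : _ * x = (m.[c])%:~R * (\prod_(r <- rs) evC r k * x)
      - ((m.[c])%:~R * \prod_(r <- rs) evC r k * x - (E ^+ size rs)%:~R * x)); last by ring.
  apply: AdivD (AdivN H); apply: dvdz_Adiv => //.
  by rewrite rpredM // big_seq rpred_prod.
apply: Adiv_coprime => //; rewrite dvdzE abszX Euclid_dvdX //.
by rewrite negb_and -[(_ %| _)%N]/((p %| E)%Z) /E cofactor_root pm'.
Qed.

(** Otherwise p would divide e at all conjugates of r, and [Adiv_cofactor] with x = 1 would make p
    divide 1. *)
Lemma cofactor_not_Adiv r : r \in rs -> ~ Adiv p (evC r e).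
Proof.
move=> rrs re; have rA := roots_minZ_Aint rrs.
have mr : evC r m = 0 by apply/eqP; rewrite -roots_minZE.
have all_e y : y \in rs -> Adiv p (evC y e * 1).
  rewrite roots_minZE mulr1 => /eqP my.
  exact: Adiv_conj rA p0 (minZ_root dA dm mr) my re.
have /(Adiv_int p0) : Adiv p (1%:~R : algC) := Adiv_cofactor Aint1 all_e.
by rewrite dvdz1 /= => /eqP p1; move: pp; rewrite p1.
Qed.

End Cofactor.

(* For an approximate root c1 of m modulo p^(v+1), e(r) (r - c1) is divisible by
   p^(v+1), where p^v is the p-part of the denominator D; so e(r) (b - a) lies in
   pO for some integer a, and e(r) (b^p - b) as well. *)
Lemma Frobenius_split c b D :
    (p %| m.[c])%Z -> ~~ (p %| m^`().[c])%Z -> b \in Aint -> (0 < D)%N ->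
    (forall r, r \in rs -> exists h, D%:R * b = evC r h) ->
  Adiv p (b ^+ p - b).
Proof.
move=> pc pc' bA D0 bh; have [D' cop DD] := pfactor_coprime pp D0.
set v := logn p D in DD.
have [c1 [pvc c1']] := hensel v pp pc pc'.
have pc1 : (p %| m.[c1])%Z.
  by apply: dvdz_trans pvc; rewrite expnS PoszM dvdz_mulr.
have [e De] := horner_subC m c1.
apply: (Adiv_cofactor De pc1 c1'); first by rewrite rpredB ?rpredX.
move=> r rrs; have rA := roots_minZ_Aint rrs; have eA := evC_aint e rA.
have [h Dh] := bh r rrs; have [k Dk] := horner_subC h c1.
have kA := evC_aint k rA.
have mr : evC r m = 0 by apply/eqP; rewrite -roots_minZE.
have pn : (p%:R : algC) != 0 by rewrite pnatr_eq0 -lt0n.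
have [g Dg] := dvdzP pvc.
have key : evC r e * (D%:R * b - (h.[c1])%:~R)
    = p%:R ^+ v.+1 * (- g%:~R * evC r k).
  rewrite Dh (evC_subC r Dk) mulrCA -(evC_subC r De) mr Dg sub0r rmorphM /=.
  by rewrite -natrX; ring.
have intpX (u : nat) (H : int) : (H * (p ^ u)%N%:Z)%:~R = H%:~R * p%:R ^+ u :> algC.
  by rewrite intrM -natrX.
have DC : D%:R = D'%:R * p%:R ^+ v :> algC by rewrite [in LHS]DD natrM natrX.
(* If p^u were the exact power of p in h(c1) for some u < v, [key] would make H1 e(r), hence e(r),
   divisible by p. *)
have pdiv u : (u <= v)%N -> ((p ^ u)%N %| h.[c1])%Z.
  elim: u => [|u IHu] ltuv; first by rewrite expn0 dvd1z.
  have /dvdzP[H1 DH] := IHu (ltnW ltuv).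
  have DHC : (h.[c1])%:~R = H1%:~R * p%:R ^+ u :> algC by rewrite DH intpX.
  suff /dvdzP[H2 DH2] : (p %| H1)%Z by rewrite DH DH2 expnS PoszM -mulrA dvdz_mull.
  apply/negPn/negP => pH1; apply: (cofactor_not_Adiv De pc1 c1' rrs).
  apply: (Adiv_coprime pp pH1 eA).
  have pu : (p%:R : algC) ^+ u != 0 by rewrite expf_neq0.
  have E : H1%:~R * evC r e
      = p%:R * (p%:R ^+ (v - u.+1) * (D'%:R * b * evC r e + p%:R * g%:~R * evC r k)).
    apply: (mulfI pu); move: key; rewrite DHC DC.
    rewrite (exprS _ v).
    have -> : (p%:R : algC) ^+ v = p%:R ^+ (v - u.+1) * p%:R * p%:R ^+ u.
      by rewrite -exprSr -exprD addSnnS subnK.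
    move/eqP; rewrite -subr_eq0 => /eqP key.
    by apply/eqP; rewrite -subr_eq0 -oppr_eq0 -[X in _ == X]key; apply/eqP; ring.
  rewrite E /Adiv mulrAC divff // mul1r.
  rewrite rpredM ?rpredX ?rpred_nat // rpredD //; first by rewrite rpredM ?rpredM ?rpred_nat.
  by rewrite rpredM ?rpredM ?rpred_nat ?Aint_int.
have /dvdzP[H1 DH] := pdiv v (leqnn v).
have DHC : (h.[c1])%:~R = H1%:~R * p%:R ^+ v :> algC by rewrite DH intpX.
have Hb : Adiv p (evC r e * (D'%:R * b - H1%:~R)).
  have pv : (p%:R : algC) ^+ v != 0 by rewrite expf_neq0.
  have -> : evC r e * (D'%:R * b - H1%:~R) = p%:R * (- g%:~R * evC r k).
    apply: (mulfI pv); move: key; rewrite DHC DC exprS => key.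
    rewrite [RHS]mulrA [_ ^+ v * p%:R]mulrC -key; ring.
  by rewrite /Adiv mulrAC divff // mul1r rpredM ?rpredN ?Aint_int.
have copz : coprimez p D' by rewrite coprimezE.
have [x [y Hxy]] := Bezoutz p D'; rewrite (eqP copz) in Hxy.
(* [y] inverts D' modulo p, so [a] is the residue of b at the primes containing r - c1. *)
pose a := y * H1.
have Ha : Adiv p (evC r e * (b - a%:~R)).
  have -> : evC r e * (b - a%:~R) =
     (x * p)%:~R * (evC r e * b) + y%:~R * (evC r e * (D'%:R * b - H1%:~R)).
    have E : (x * p)%:~R + y%:~R * D'%:R = 1 :> algC.
      by have := congr1 (intr : int -> algC) Hxy; rewrite intrD (intrM _ y).
    have Eb : b = (x * p)%:~R * b + y%:~R * (D'%:R * b).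
      by rewrite mulrA -mulrDl E mul1r.
    by rewrite {1}Eb /a intrM; ring.
  apply: AdivD; last by apply: AdivM Hb; exact: Aint_int.
  by apply: dvdz_Adiv; rewrite ?dvdz_mull ?rpredM.
(* b^p - a^p is a multiple of b - a, and p divides a^p - a by Fermat. *)
have -> : evC r e * (b ^+ p - b) = (\sum_(i < p) b ^+ (p.-1 - i) * a%:~R ^+ i)
     * (evC r e * (b - a%:~R)) + (a ^+ p - a)%:~R * evC r e - evC r e * (b - a%:~R).
  have E := subrXX b (a%:~R : algC) p; rewrite rmorphB rmorphXn /=.
  have -> : b ^+ p - b = (b ^+ p - a%:~R ^+ p) + (a%:~R ^+ p - a%:~R) - (b - a%:~R) by ring.
  by rewrite E; ring.
apply: AdivD (AdivN Ha); apply: AdivD.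
  by apply: AdivM Ha; apply: rpred_sum => i _; rewrite rpredM ?rpredX ?Aint_int.
by apply: dvdz_Adiv => //; exact: dvdz_prime_fermat.
Qed.

End Frobenius.

(** * From the Galois hypothesis to a divisibility modulo p *)

Lemma horner_map_ratr (F1 F2 : fieldType) (f : {rmorphism F1 -> F2}) (h : {poly rat}) x :
  f (map_poly ratr h).[x] = (map_poly ratr h).[f x].
Proof.
rewrite -horner_map -map_poly_comp; congr _.[_].
by apply: eq_map_poly => a /=; rewrite fmorph_rat.
Qed.

Lemma polyOver1_ratr (L : fieldExtType rat) (u : {poly L}) :
  u \is a polyOver 1%VS -> exists h : {poly rat}, u = map_poly ratr h.
Proof.
case/polyOver1P=> h ->; exists h; apply: eq_map_poly => a.
exact: alg_num_field.
Qed.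

Lemma rat_scale_int (h : {poly rat}) : exists (D : nat) (g : {poly int}),
  (0 < D)%N /\ forall x : algC, D%:R * (map_poly ratr h).[x] = evC x g.
Proof.
have [g [a an ->]] := rat_poly_scale h.
exists `|a|%N, ((sgz a)%:P * g); split=> [|x]; first by rewrite absz_gt0.
have an' : (a%:~R : algC) != 0 by rewrite intr_eq0.
have -> : evC x ((sgz a)%:P * g) = (sgz a)%:~R * evC x g.
  by rewrite rmorphM [evC x _%:P]evCE map_polyC hornerC.
have -> : (map_poly ratr (a%:~R^-1 *: map_poly intr g)).[x] = a%:~R^-1 * evC x g.
  rewrite linearZ /= hornerZ fmorphV /= ratr_int -map_poly_comp.
  by congr (_ * _.[_]); apply: eq_map_poly => i /=; rewrite ratr_int.
rewrite mulrA; congr (_ * _).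
by rewrite -[_%:R]/((`|a|%N%:Z)%:~R) abszE {1}normrEsg rmorphM /= mulfK // sgrEz intz.
Qed.

(** All roots of [m] are images under [iota] of conjugates of z inside Q(z), and each of these
    generates Q(z). *)
Lemma galois_conj_rat (L : splittingFieldType rat) (iota : {rmorphism L -> algC})
    (z : L) m b r :
    galois 1%VS <<1; z>>%VS -> is_minZ (iota z) m ->
    evC b m = 0 -> evC r m = 0 ->
  exists h : {poly rat}, b = (map_poly ratr h).[r].
Proof.
move=> gal [mm md mmin] mb mr; set E := <<1; z>>%AS.
have zE : z \in E by exact: memv_adjoin.
have /(galois_factors (sub1v _))/(_ z zE)[s [_ _ Ds]] := gal.
have [P DP] := polyOver1_ratr (minPolyOver 1 z).
have Pz : root (map_poly ratr P) z by rewrite -DP root_minPoly.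
have conj_iota t : evC t m = 0 -> exists x : gal_of E, t = iota (x z).
  move=> mt; have [D [g [D0 Dg]]] := rat_scale_int P.
  have [h Dh] : exists h, g = h * m.
    by apply: mmin; rewrite -Dg -horner_map_ratr (rootP Pz) rmorph0 mulr0.
  have Pt : root (map_poly ratr P) t.
    have /eqP := Dg t; rewrite Dh rmorphM mt mulr0 mulf_eq0 pnatr_eq0.
    by rewrite gtn_eqF.
  have : root (map_poly iota (minPoly 1 z)) t.
    rewrite DP -map_poly_comp (@eq_map_poly _ _ _ ratr) // => a.
    exact: fmorph_rat.
  rewrite Ds big_map rmorph_prod.
  rewrite (eq_bigr (fun i : gal_of E => 'X - (iota (i z))%:P)); last first.
    by move=> i _; rewrite rmorphB /= map_polyX map_polyC.
  rewrite -(big_map (fun i : gal_of E => iota (i z)) predT (fun a => 'X - a%:P)).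
  by rewrite root_prod_XsubC => /mapP[x _ ->]; exists x.
have [[x Dr] [y Db]] := (conj_iota r mr, conj_iota b mb).
(* Products in the Galois group act from left to right, so x maps [w] to y z; [h] expresses [w]
   through z. *)
pose w := (y * x^-1)%g z; have wE : w \in E by exact: memv_gal.
have [h Dh] := polyOver1_ratr (Fadjoin_polyOver 1 z w).
have Exy := galM (y * x^-1)%g x zE; rewrite mulgKV in Exy.
exists h; rewrite Dr Db -horner_map_ratr; congr (iota _).
by rewrite -[RHS](horner_map_ratr x) -Dh (Fadjoin_poly_eq wE).
Qed.

Lemma uniform_denominator (s : seq algC) (b : algC) :
    (forall r, r \in s -> exists h : {poly rat}, b = (map_poly ratr h).[r]) ->
  exists2 D : nat, (0 < D)%N &
    forall r, r \in s -> exists h, D%:R * b = evC r h.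
Proof.
elim: s => [|r s IHs] H; first by exists 1%N.
have [D1 D10 HD1] := IHs (fun x xs => H x (mem_behead (s := r :: s) xs)).
have [h Dh] := H r (mem_head _ _); have [D2 [g [D20 Hg]]] := rat_scale_int h.
exists (D1 * D2)%N; first by rewrite muln_gt0 D10.
move=> x; rewrite inE natrM => /predU1P[->|/HD1[k Dk]].
  by exists (D1%:R * g); rewrite rmorphM rmorph_nat -Hg -Dh mulrA.
by exists (D2%:R * k); rewrite rmorphM rmorph_nat -Dk mulrAC mulrC.
Qed.

Definition pFp (p : nat) : {rmorphism {poly int} -> {poly 'F_p}} :=
  map_poly (intr : int -> 'F_p).

Lemma pFpX p : pFp p 'X = 'X.
Proof. exact: map_polyX. Qed.

(** Homogenizing the minimal polynomial of (b^p - b)/p gives G in Z[X] with G(b) = 0 that is a power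
    of X^p - X modulo p. P divides the product of these G, over Z because P is monic. *)
Lemma frobenius_dvdp (P : {poly int}) (bs : seq algC) (p : nat) :
    prime p -> P \is monic -> pZC P = \prod_(b <- bs) ('X - b%:P) ->
    (forall b, b \in bs -> b \in Aint /\ Adiv p (b ^+ p - b)) ->
  exists n, pFp p P %| ('X^p - 'X) ^+ n.
Proof.
move=> pp Pm DP Hb.
have [G [n [GP Gn]]] : exists (G : {poly int}) n,
    pZC P %| pZC G /\ pFp p G = ('X^p - 'X) ^+ n.
  rewrite DP; elim: bs Hb {DP} => [|b bs IHbs] H.
    by exists 1, 0%N; rewrite big_nil !rmorph1 dvd1p expr0.
  have [G1 [n1 [H1 E1]]] := IHbs (fun x xs => H x (mem_behead (s := b :: bs) xs)).
  have [bA tA] := H b (mem_head _ _).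
  have [f [fm ft _]] := minZ_exists tA.
  have [G [k [DG HG]]] := homogenize ('X^p - 'X) p fm.
  exists (G * G1), ((size f).-1 + n1)%N; split; last first.
    rewrite rmorphM E1 exprD DG rmorphD rmorphM rmorphXn rmorph_nat.
    rewrite (_ : p%:R = 0); last by rewrite -polyC_natr pchar_Fp_0.
    by rewrite mul0r addr0 rmorphB rmorphXn pFpX.
  rewrite big_cons rmorphM dvdp_mul // dvdp_XsubCl evC_rootE.
  rewrite (HG b ((b ^+ p - b) / p%:R)) ?ft ?mulr0 // mulrC mulfVK.
    by rewrite rmorphB rmorphXn evC_X.
  by rewrite pnatr_eq0 -lt0n prime_gt0.
exists n; rewrite -Gn.
have DG := Pdiv.RingMonic.rdivp_eq Pm G.
suff R0 : Pdiv.CommonRing.rmodp G P = 0 by rewrite DG R0 addr0 rmorphM dvdp_mull.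
set R := Pdiv.CommonRing.rmodp G P in DG *.
have sR : (size R < size P)%N by rewrite Pdiv.Ring.ltn_rmodpN0 // monic_neq0.
have : pZC P %| pZC R.
  by move: GP; rewrite {1}DG rmorphD rmorphM /= dvdp_addr // dvdp_mull.
apply: contraTeq => Rn0; apply/negP => /dvdp_leq.
rewrite map_poly_eq0_id0 ?intr_eq0 ?lead_coef_eq0 // Rn0 => /(_ isT).
by rewrite !(size_map_inj_poly (@intr_inj algC)) ?mulr0z // leqNgt sR.
Qed.
(** The simple root c of P modulo p passes to the minimal polynomial of d, so [Frobenius_split]
    applies to all conjugates of d. The only other possible root of P, x = 1, satisfies the
    congruence trivially. *)
Lemma galois_hseq_dvdp (L : splittingFieldType rat) (iota : {rmorphism L -> algC})
    (z : L) (d : algC) n (p : nat) (c : int) :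
    iota z = d -> galois 1%VS <<1; z>>%VS ->
    (0 < n)%N -> d \is Num.real -> hseq (d - 2) n = 0 ->
    (forall x, x \is Num.real -> hseq (x - 2) n = 0 -> x <= d) ->
    let P := hseq ('X - 2) n in
    prime p -> (p %| P.[c])%Z -> ~~ (p %| P^`().[c])%Z -> ~~ (p %| c - 1)%Z ->
  exists N, pFp p P %| ('X^p - 'X) ^+ N.
Proof.
move=> zd gal n0 dr dn0 dmax P pp pP pP' pc1.
have Pm : P \is monic by have [Hm _] := @hseq_size int 2 n; rewrite polyC_natr in Hm.
have [bs DP] : exists bs, pZC P = \prod_(b <- bs) ('X - b%:P).
  by apply: algC_roots; exact: monic_map.
have bsE b : (b \in bs) = (evC b P == 0).
  by rewrite -evC_rootE DP root_prod_XsubC.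
have bA b : b \in bs -> b \in Aint.
  rewrite bsE -evC_rootE => Pb; apply: (root_monic_Aint Pb); first exact: monic_map.
  by apply/polyOverP => i; rewrite coef_map intr_int.
have dA : d \in Aint by rewrite bA // bsE evC_hseq dn0.
have [m dm] := minZ_exists dA; have [mm md mmin] := dm.
have [rs Dm] : exists rs, pZC m = \prod_(r <- rs) ('X - r%:P).
  by apply: algC_roots; exact: monic_map.
have bm b : b \in bs -> evC b m = 0 \/ b = 1.
  by rewrite bsE evC_hseq => /eqP; apply: hseq_roots_conj dmax.
have [g Dg] : exists g, P = g * m by apply: mmin; rewrite evC_hseq.
have [e De] := horner_subC m c.
have p0 := prime_gt0 pp.
have pm : (p %| m.[c])%Z.
  (* Each root b of P is 1 or a root of m, so c - b divides m(c) (c - 1); the product of the c - b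
     is P(c). *)
  have [t tA Dt] : exists2 t, t \in Aint &
      ((m.[c] * (c - 1)) ^+ size bs)%:~R = (P.[c])%:~R * t.
    have -> : (P.[c])%:~R = \prod_(b <- bs) (c%:~R - b) :> algC.
      rewrite -[LHS]/(intr _) -horner_map /= DP horner_prod.
      by apply: eq_bigr => r _; rewrite hornerXsubC.
    elim: bs bm bA {DP bsE} => [|b bs IHbs] Hm HA.
      by exists 1; rewrite ?Aint1 // big_nil mulr1.
    have [t tA Dt] := IHbs (fun x xs => Hm x (mem_behead (s := b :: bs) xs))
        (fun x xs => HA x (mem_behead (s := b :: bs) xs)).
    rewrite /= exprS intrM Dt big_cons.
    have [mb|b1] := Hm b (mem_head _ _).
      exists (evC b e * (c - 1)%:~R * t).
        by rewrite rpredM // rpredM ?Aint_int // evC_aint // HA ?mem_head.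
      have := evC_subC b De; rewrite mb sub0r => /(canRL opprK) Dmc.
      by rewrite intrM Dmc; ring.
    exists ((m.[c])%:~R * t); first by rewrite rpredM ?Aint_int.
    by rewrite b1 intrM rmorphB /= rmorph1; ring.
  have : Adiv p ((m.[c] * (c - 1)) ^+ size bs)%:~R by rewrite Dt; exact: dvdz_Adiv.
  move/(Adiv_int p0); rewrite dvdzE abszX abszM Euclid_dvdX // Euclid_dvdM //.
  by rewrite -!dvdzE (negPf pc1) orbF => /andP[].
have pm' : ~~ (p %| m^`().[c])%Z.
  apply: contra pP'; rewrite Dg derivM hornerD !hornerM => H.
  by rewrite rpredD // dvdz_mull.
apply: (frobenius_dvdp pp Pm DP) => b bbs; split; first exact: bA.
have [mb|->] := bm b bbs; last by rewrite expr1n subrr /Adiv mul0r rpred0.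
have [D D0 HD] : exists2 D : nat, (0 < D)%N &
    forall r, r \in rs -> exists h, D%:R * b = evC r h.
  apply: uniform_denominator => r; rewrite (roots_minZE Dm) => /eqP mr.
  by have := galois_conj_rat (iota := iota) gal; rewrite zd => /(_ m b r dm mb mr).
exact: (Frobenius_split pp dA dm Dm pm pm' (bA b bbs) D0 HD).
Qed.
(** * Roots modulo p *)

Lemma deriv_natr (R : nzRingType) n : (n%:R : {poly R})^`() = 0.
Proof. by rewrite -polyC_natr derivC. Qed.

Lemma deriv_hseq (R : comNzRingType) n (h := hseq ('X - 2 : {poly R})) :
  [/\ (h 0)^`() = 0, (h 1)^`() = 2 * ('X - 2) - 1 &
   (h n.+2)^`() = 2 * ('X - 2) * h n.+1 + (('X - 2) ^+ 2 - 2) * (h n.+1)^`()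
                  - (h n)^`()].
Proof.
split; first exact: (deriv_natr _ 1).
  rewrite /h /hseq /= !derivB !deriv_natr expr2 derivM derivB derivX deriv_natr; ring.
rewrite /h hseqSS !derivB derivM !derivB expr2 derivM derivB derivX !deriv_natr; ring.
Qed.

Lemma horner_hseq (R : comNzRingType) n (x : R) :
  (hseq ('X - 2) n).[x] = hseq (x - 2) n.
Proof.
rewrite -[LHS]/(horner_eval x _) rmorph_hseq; congr hseq.
by rewrite rmorphB /= /horner_eval hornerX -polyC_natr hornerC.
Qed.

Lemma horner_natr (R : nzRingType) n (x : R) : (n%:R : {poly R}).[x] = n%:R.
Proof. by rewrite -polyC_natr hornerC. Qed.

(** At x = 0, that is y = -2, the recurrence has the double characteristic root 1, so the derivative
    is a cubic in n; the factor 6 clears denominators. The same happens at x = 4, that is y = 2. *)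
Lemma deriv_hseq_at0 n : 6 * (hseq ('X - 2) n)^`().[0] =
  3 - (2 * n%:R + 1) * (4 * n%:R ^+ 2 + 4 * n%:R + 3) :> int.
Proof.
elim/nat_ind2: n => [||n IH0 IH1].
- by have [-> _ _] := deriv_hseq int 0; rewrite horner0; ring.
- by have [_ -> _] := deriv_hseq int 0; rewrite !(horner_natr, hornerD, hornerN, hornerM, hornerX, hornerC); ring.
have [_ _ ->] := deriv_hseq int n.
set a := _^`() in IH0 *; set b := _^`() in IH1 *.
rewrite expr2 !(horner_natr, horner_hseq, hornerD, hornerN, hornerM, hornerX) sub0r hseq_atN2.
rewrite -!natr1 in IH0 IH1 *.
have -> : 6 * (2 * - 2 * (1 + 2 * (n%:R + 1)) + (- 2 * - 2 - 2) * b.[0] - a.[0]) =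
  6 * (2 * - 2 * (1 + 2 * (n%:R + 1))) + 2 * (6 * b.[0]) - 6 * a.[0] :> int by ring.
by rewrite IH0 IH1; ring.
Qed.

Lemma deriv_hseq_at4 n : 6 * (hseq ('X - 2) n)^`().[4] =
  9 + (1 - 2 * n%:R) * (4 * n%:R ^+ 2 - 4 * n%:R - 9) :> int.
Proof.
elim/nat_ind2: n => [||n IH0 IH1].
- by have [-> _ _] := deriv_hseq int 0; rewrite horner0; ring.
- by have [_ -> _] := deriv_hseq int 0; rewrite !(horner_natr, hornerD, hornerN, hornerM, hornerX, hornerC); ring.
have [_ _ ->] := deriv_hseq int n.
set a := _^`() in IH0 *; set b := _^`() in IH1 *.
rewrite expr2 !(horner_natr, horner_hseq, hornerD, hornerN, hornerM, hornerX).
rewrite (_ : 4 - 2 = 2 :> int) // hseq_at2 -!natr1 in IH0 IH1 *.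
have -> : 6 * (2 * 2 * (1 - 2 * (n%:R + 1)) + (2 * 2 - 2) * b.[4] - a.[4]) =
  6 * (2 * 2 * (1 - 2 * (n%:R + 1))) + 2 * (6 * b.[4]) - 6 * a.[4] :> int by ring.
by rewrite IH0 IH1; ring.
Qed.

(** Put A = s^(2n-1) F(s) and B = s^(1-2n) F(1/s). Then (s^2 - s^(-2)) [hseq y n] is A - B, the
    first factor on the right is A + B, and the equation is s d/ds of A - B with denominators
    cleared. Induction proves it over any ring. *)
Lemma hseq_ode (R : comNzRingType) n :
  let y : {poly R} := 'X - 2 in
  let c := 4 + 4 * y - y ^+ 3 in
  2 * c * y * (y ^+ 2 - 4) * (hseq y n)^`()
    + (2 * c * (2 * y ^+ 2 - 4) - y * (y ^+ 2 - 4) * (4 - 3 * y ^+ 2)) * hseq y n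
  = (2 * hseq y n.+1 - (y ^+ 2 - 2) * hseq y n)
    * ((4 * n%:R - 2) * c + (16 + 8 * y - 2 * y ^+ 2 - 3 * y ^+ 3)).
Proof.
move=> y c; elim/nat_ind2: n => [||n IH0 IH1].
- by have [-> _ _] := deriv_hseq R 0; rewrite /hseq /= /c; ring.
- by have [_ -> _] := deriv_hseq R 0; rewrite hseqSS /hseq /= /c -/y; ring.
have [_ _ ->] := deriv_hseq R n; rewrite -/y.
rewrite (hseqSS y n.+1) hseqSS in IH1 *.
set a := hseq y n in IH0 IH1 *; set b := hseq y n.+1 in IH0 IH1 *.
set a' := a^`() in IH0 *; set b' := b^`() in IH1 *.
have E1 : n.+1%:R = n%:R + 1 :> {poly R} by rewrite natr1.
have E2 : n.+2%:R = n%:R + 2 :> {poly R} by rewrite -addn2 natrD.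
rewrite E1 in IH1; rewrite E2.
transitivity ((y ^+ 2 - 2) * (2 * c * y * (y ^+ 2 - 4) * b'
    + (2 * c * (2 * y ^+ 2 - 4) - y * (y ^+ 2 - 4) * (4 - 3 * y ^+ 2)) * b)
  - (2 * c * y * (y ^+ 2 - 4) * a'
    + (2 * c * (2 * y ^+ 2 - 4) - y * (y ^+ 2 - 4) * (4 - 3 * y ^+ 2)) * a)
  + 4 * c * y ^+ 2 * (y ^+ 2 - 4) * b); first by ring.
by rewrite IH0 IH1; ring.
Qed.

(** * Counting roots in a finite field *)

(** Q splits over F. The quotient of Q by gcd(Q, Q') has distinct roots, all of them roots of W; the
    gcd has at most the degree of f. *)
Lemma finField_roots_count (F : finFieldType) (Q f W : {poly F}) N :
    Q != 0 -> Q %| ('X^#|F| - 'X) ^+ N -> gcdp Q Q^`() %| f -> f != 0 ->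
    W != 0 -> (forall x, root Q x -> root W x) ->
  (size Q < size W + size f)%N.
Proof.
move=> Qn QN gf fn Wn QW; set g := gcdp Q Q^`() in gf.
have gQ : g %| Q := dvdp_gcdl _ _.
have gn : g != 0 by rewrite gcdp_eq0 negb_and Qn.
have sepw := make_separable Qn; rewrite -/g in sepw.
set w := Q %/ g in sepw; have Dw : Q = w * g by rewrite divpK.
have wn : w != 0 by apply: contra_neq Qn => w0; rewrite Dw w0 mul0r.
have : w %| \prod_(x <- flatten (nseq N (enum F))) ('X - x%:P).
  apply: dvdp_trans (dvdp_trans QN _); first by rewrite Dw dvdp_mulIl.
  have -> : 'X^#|F| - 'X = \prod_(x <- enum F) ('X - x%:P).
    by rewrite finField_genPoly big_enum.
  elim: N {QN} => [|N IHN]; first by rewrite big_nil expr0.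
  by rewrite exprS /= big_cat dvdp_mul.
case/dvdp_prod_XsubC => ms; set rs := mask _ _ => Dwr.
have Urs : uniq rs by rewrite -separable_prod_XsubC -(eqp_separable Dwr).
have Wrs : all (root W) rs.
  apply/allP => x xrs; apply: QW; rewrite Dw rootM.
  by rewrite (eqp_root Dwr) root_prod_XsubC xrs.
have ltrW := max_poly_roots Wn Wrs Urs.
have := eqp_size Dwr; rewrite size_prod_XsubC => Hs.
by rewrite Dw size_mul // Hs addSn -addSn leq_add // dvdp_leq.
Qed.

(** * Closed formulas in s *)

Section HseqFormula.

Variables (K : fieldType) (s : K).
Hypothesis s0 : s != 0.
Let t := s^-1.
Let F (x : K) := x ^+ 3 - x ^+ 2 - x - 1.

Lemma hseq_formula n :
  (s ^+ 2 - t ^+ 2) * hseq (s + t) n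
    = s ^+ n.*2 * (t * F s) - t ^+ n.*2 * (s * F t).
Proof.
elim/nat_ind2: n => [||n IH0 IH1].
- by rewrite /hseq /F /= /t; field.
- by rewrite /hseq /F /= /t; field.
rewrite hseqSS mulrBr mulrCA {}IH0 {}IH1 !doubleS !exprS /t exprVn.
by field; rewrite s0 expf_neq0.
Qed.

(** This is [hseq_formula] at index -n. *)
Lemma hneg_formula n :
  (s ^+ 2 - t ^+ 2) * hneg (s + t) n
    = t ^+ n.*2 * (t * F s) - s ^+ n.*2 * (s * F t).
Proof.
elim/nat_ind2: n => [||n IH0 IH1].
- by rewrite /hneg /F /= /t; field.
- by rewrite /hneg /F /= /t; field.
rewrite hnegSS mulrBr mulrCA {}IH0 {}IH1 !doubleS !exprS /t exprVn.
by field; rewrite s0 expf_neq0.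
Qed.

Hypothesis st : s ^+ 2 - t ^+ 2 != 0.

Lemma hseq_eq n m : s ^+ n.*2 = s ^+ m.*2 -> hseq (s + t) n = hseq (s + t) m.
Proof.
by move=> E; apply: (mulfI st); rewrite !hseq_formula /t !exprVn E.
Qed.

Lemma hseq_hneg n m : s ^+ n.*2 = t ^+ m.*2 -> hseq (s + t) n = hneg (s + t) m.
Proof.
move=> E; apply: (mulfI st); rewrite hseq_formula hneg_formula E; congr (_ - _ * _).
by rewrite [in LHS]/t exprVn E /t exprVn invrK.
Qed.

End HseqFormula.

(** By additivity of Frobenius, s^p and s^(-p) have the sum and the product of s and 1/s. *)
Lemma pchar_expr_or (K : fieldType) (p : nat) (s : K) :
    p \in [pchar K] -> s != 0 -> (s + s^-1) ^+ p = s + s^-1 ->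
  s ^+ p = s \/ s ^+ p = s^-1.
Proof.
move=> charK s0; have pK : [pchar K].-nat p by rewrite pnatE ?(pcharf_prime charK).
rewrite exprDn_pchar // exprVn => E.
have sp0 : s ^+ p != 0 by rewrite expf_neq0.
have : (s ^+ p - s) * (s ^+ p - s^-1) = 0.
  rewrite (_ : _ * _ = s ^+ p * s ^+ p - s ^+ p * (s + s^-1) + 1); last by field.
  by rewrite -E; field.
by move/eqP; rewrite mulf_eq0 !subr_eq0 => /orP[/eqP|/eqP]; [left|right].
Qed.

Lemma Fp_param (p : nat) (y : 'F_p) : exists (K : fieldType)
  (f : {rmorphism 'F_p -> K}) (s : K), s != 0 /\ f y = s + s^-1.
Proof.
have [K [f _]] := countable_algebraic_closure ('F_p : countFieldType).
have [s Ps] : exists s, root ('X^2 - (f y)%:P * 'X + 1 : {poly K}) s.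
  apply/closed_rootP; rewrite -addrA size_polyDl ?size_polyXn //.
  rewrite (leq_ltn_trans (size_polyD _ _)) // size_poly1 gtn_max size_polyN andbT.
  by rewrite (leq_ltn_trans (size_polyMleq _ _)) // size_polyX addn2 /= !ltnS size_polyC_leq1.
move: Ps; rewrite /root !hornerE => /eqP Ps.
have s0 : s != 0.
  by apply: contra_eq_neq Ps => ->; rewrite expr2 !mulr0 subr0 add0r oner_eq0.
exists K, f, s; split=> //; apply: (mulIf s0); rewrite mulrDl mulVf // -expr2.
by apply/eqP; rewrite eq_sym -subr_eq0 -Ps; apply/eqP; ring.
Qed.
Lemma horner_hneg (R : comNzRingType) n (x : R) :
  (hneg ('X - 2) n).[x] = hneg (x - 2) n.
Proof.
rewrite -[LHS]/(horner_eval x _) rmorph_hneg; congr hneg.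
by rewrite rmorphB /= /horner_eval hornerX -polyC_natr hornerC.
Qed.

(** s^(pl) is s^l or s^(-l). For pl = 2n + 1 this turns s^(2n) into s^(2j) or s^(-2j-2); for pl = 2n
    - 1, into s^(2j+2) or s^(-2j). Negative exponents lead to [hneg]. *)
Lemma hseq_Fp_roots (p n l j : nat) (y : 'F_p) :
    prime p -> y != 0 -> y ^+ 2 - 4 != 0 -> l = j.*2.+1 -> hseq y n = 0 ->
  ((p * l)%N = n.*2.+1 -> hseq y j = 0 \/ hneg y j.+1 = 0) /\
  ((p * l).+1 = n.*2 -> hseq y j.+1 = 0 \/ hneg y j = 0).
Proof.
move=> pp y0 y4 Dl yn0; have [K [f [s [s0 fy]]]] := Fp_param y.
have charK : p \in [pchar K] by rewrite (fmorph_pchar f) pchar_Fp.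
have yp : y ^+ p = y by have := expf_card y; rewrite card_Fp.
have sp : (s + s^-1) ^+ p = s + s^-1 by rewrite -fy -rmorphXn yp.
(* The square of this difference is y^2 (y^2 - 4). *)
have st : s ^+ 2 - s^-1 ^+ 2 != 0.
  have : f (y ^+ 2 * (y ^+ 2 - 4)) != 0 by rewrite fmorph_eq0 mulf_neq0 ?expf_neq0.
  apply: contra_neq => E.
  rewrite rmorphM rmorphB !rmorphXn rmorph_nat fy.
  transitivity ((s ^+ 2 - s^-1 ^+ 2) ^+ 2); first by field.
  by rewrite E expr0n.
have fh k : hseq (s + s^-1) k = 0 -> hseq y k = 0.
  by move=> E; apply/eqP; rewrite -(fmorph_eq0 f) rmorph_hseq fy E.
have fn k : hneg (s + s^-1) k = 0 -> hneg y k = 0.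
  by move=> E; apply/eqP; rewrite -(fmorph_eq0 f) rmorph_hneg fy E.
have sn0 : hseq (s + s^-1) n = 0 by rewrite -fy -rmorph_hseq yn0 rmorph0.
have [E|E] := pchar_expr_or charK s0 sp; split=> Hpl.
- left; apply: fh; rewrite -(hseq_eq s0 st (n := n)) //; apply: (mulIf s0).
  by rewrite -!exprSr -Hpl -Dl exprM E.
- left; apply: fh; rewrite -(hseq_eq s0 st (n := n)) //.
  by rewrite -Hpl exprSr exprM E doubleS exprSr -Dl.
- right; apply: fn; rewrite -(hseq_hneg s0 st (n := n)) //; apply: (mulIf s0).
  by rewrite -exprSr -Hpl exprM E doubleS exprSr -mulrA mulVf // mulr1 Dl.
right; apply: fn; rewrite -(hseq_hneg s0 st (n := n)) //.
by rewrite -Hpl exprSr exprM E Dl exprSr -mulrA mulVf // mulr1.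
Qed.

(** * No complete splitting modulo p *)

Lemma dvdz_small (p m : nat) : (0 < m < p)%N -> ~~ (p %| m%:Z)%Z.
Proof. by move=> /andP[m0 mp]; rewrite dvdzE /= gtnNdvd. Qed.

Lemma deriv_hseq_at0_ndvd (p n : nat) : (5 <= p)%N -> prime p ->
  (p %| n.*2.+1)%N -> ~~ (p %| (hseq ('X - 2) n)^`().[0])%Z.
Proof.
move=> p5 pp pn; apply/negP => H.
have pn' : (p %| (2 * n%:R + 1 : int)%R)%Z.
  by rewrite (_ : _ + _ = n.*2.+1%:Z) // natz; lia.
have : (p %| 3%:Z)%Z.
  rewrite (_ : 3%:Z = 6 * (hseq ('X - 2) n)^`().[0]
     + (2 * n%:R + 1) * (4 * n%:R ^+ 2 + 4 * n%:R + 3)).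
    by apply: rpredD; [exact: dvdz_mull | exact: dvdz_mulr].
  by rewrite deriv_hseq_at0 subrK.
by apply/negP/dvdz_small; lia.
Qed.

Lemma deriv_hseq_at4_ndvd (p n : nat) : (5 <= p)%N -> prime p ->
  (p %| n.*2.-1)%N -> (0 < n)%N -> ~~ (p %| (hseq ('X - 2) n)^`().[4])%Z.
Proof.
move=> p5 pp pn n0; apply/negP => H.
have pn' : (p %| (1 - 2 * n%:R : int)%R)%Z.
  rewrite -rpredN (_ : - _ = n.*2.-1%:Z) // natz; lia.
have : (p %| 9%:Z)%Z.
  rewrite (_ : 9%:Z = 6 * (hseq ('X - 2) n)^`().[4]
     - (1 - 2 * n%:R) * (4 * n%:R ^+ 2 - 4 * n%:R - 9)).
    by apply: rpredB; [exact: dvdz_mull | exact: dvdz_mulr].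
  by rewrite deriv_hseq_at4 addrK.
rewrite dvdzE /= -[9%N]/(3 ^ 2)%N Euclid_dvdX // andbT.
by apply/negP; rewrite gtnNdvd //; lia.
Qed.

Lemma pFp_hseq p n : pFp p (hseq ('X - 2) n) = hseq ('X - 2) n.
Proof. by rewrite rmorph_hseq rmorphB pFpX rmorph_nat. Qed.

Lemma pFp_deriv p (P : {poly int}) : (pFp p P)^`() = pFp p P^`().
Proof. by rewrite deriv_map. Qed.

Lemma pFp_horner p (P : {poly int}) (c : int) :
  (pFp p P).[c%:~R] = (P.[c])%:~R.
Proof. by rewrite horner_map. Qed.

(* A common factor of Q and Q' divides the right side of the differential
   equation, and is coprime to its first factor by hseq_bezout. *)
Lemma gcdp_hseq (p n : nat) (Q := hseq ('X - 2 : {poly 'F_p}) n)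
    (y := 'X - 2 : {poly 'F_p}) :
    prime p -> (5 <= p)%N ->
  gcdp Q Q^`() %| (4 * n%:R - 2) * (4 + 4 * y - y ^+ 3)
                  + (16 + 8 * y - 2 * y ^+ 2 - 3 * y ^+ 3).
Proof.
move=> pp p5; set g := gcdp _ _.
have gQ : g %| Q := dvdp_gcdl _ _.
have gQ' : g %| Q^`() := dvdp_gcdr _ _.
have ode := hseq_ode 'F_p n; rewrite /= -/y -/Q in ode.
set V := 2 * hseq y n.+1 - (y ^+ 2 - 2) * Q in ode.
have cop : coprimep g V.
  have [a [b Hab]] := hseq_bezout y n; rewrite -/Q in Hab.
  rewrite coprimep_def; set h := gcdp g V.
  have hQ : h %| Q := dvdp_trans (dvdp_gcdl _ _) gQ.
  have hV : h %| V := dvdp_gcdr _ _.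
  have h2 : h %| 2 * hseq y n.+1.
    by rewrite -(subrK ((y ^+ 2 - 2) * Q) (2 * _)) dvdp_add // dvdp_mull.
  have : h %| 2.
    rewrite (_ : 2 = 2 * a * Q + b * (2 * hseq y n.+1)); last by rewrite -[LHS]mulr1 -Hab; ring.
    by rewrite dvdp_add // dvdp_mull.
  have two : (2%:P : {poly 'F_p}) %= 1.
    by rewrite polyC_eqp1 -(dvdn_pcharf (pchar_Fp pp)) gtnNdvd //; lia.
  by rewrite -polyC_natr (eqp_dvdr _ two) dvdp1.
by rewrite -(Gauss_dvdpr _ cop) -ode dvdp_add // dvdp_mull.
Qed.

(** Contradicts the degree counts below, where l p is 2n + 1 or 2n - 1. The case l = 1, p = 5 has to
    be left out. *)
Lemma odd_mul_bound l p : odd l -> (5 <= p)%N -> (7 <= l * p)%N ->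
  (2 * l + 4 < l * p)%N.
Proof.
case: l => [|[|[|l]]] // _ p5 _.
by have := leq_mul (leqnn l.+3) p5; lia.
Qed.

(** Outside y = 0 and y = -2 the roots of Q are roots of A or B, so W has degree 4j + 3 = 2l + 1.
    Multiple roots cost at most 2 more, whence 2n <= 2l + 3. *)
Lemma hseq_Fp_nosplit_succ (p n : nat) : prime p -> (5 <= p)%N -> (3 <= n)%N ->
    (p %| n.*2.+1)%N ->
  ~ exists N, pFp p (hseq ('X - 2) n) %| ('X^p - 'X) ^+ N.
Proof.
move=> pp p5 n3 pn [N]; rewrite pFp_hseq.
set y : {poly 'F_p} := 'X - 2; set Q := hseq y n => QN.
have Dy : y = 'X - 2%:P by rewrite polyC_natr.
have [l Dl] := dvdnP pn; pose j := l./2.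
have lodd : odd l by have := congr1 odd Dl; rewrite /= odd_double oddM => /esym/andP[].
have Dlj : l = j.*2.+1 by rewrite -[LHS]odd_double_half lodd.
have [Qm sQ] := hseq_size (2 : 'F_p) n; rewrite -Dy -/Q in Qm sQ.
have [Am sA] := hseq_size (2 : 'F_p) j; rewrite -Dy in Am sA.
have [_ sB] := hneg_size (2 : 'F_p) j; have [Bm _] := hneg_size (2 : 'F_p) j.+1.
rewrite -Dy in sB Bm.
have nz k : (0 < k < p)%N -> (k%:R : 'F_p) != 0.
  by case/andP=> k0 kp; rewrite -(dvdn_pcharf (pchar_Fp pp)) gtnNdvd.
have n21 : (2 * n%:R + 1 : 'F_p) = 0.
  rewrite (_ : _ + 1 = n.*2.+1%:R); last by rewrite -[n.*2.+1]addn1 -[n.*2]mul2n natrD natrM.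
  by apply/eqP; rewrite -(dvdn_pcharf (pchar_Fp pp)).
(* As 2n + 1 = 0 in F_p, [gcdp_hseq] leaves y (y - 4)(y + 2); the factor y + 2 = X drops out because
   0 is a simple root of Q. *)
have gf : gcdp Q Q^`() %| y * (y - 4).
  have : gcdp Q Q^`() %| y * (y - 4) * (y + 2).
    have := gcdp_hseq n pp p5; rewrite -/y -/Q.
    have -> : (4 * n%:R - 2) * (4 + 4 * y - y ^+ 3)
                  + (16 + 8 * y - 2 * y ^+ 2 - 3 * y ^+ 3)
       = 2 * (2 * n%:R + 1) * (4 + 4 * y - y ^+ 3) + y * (y - 4) * (y + 2) by ring.
    rewrite (_ : 2 * n%:R + 1 = (2 * n%:R + 1)%:P :> {poly 'F_p}).
      by rewrite n21 mulr0 mul0r add0r.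
    by rewrite polyCD polyCM !polyC_natr.
  rewrite Gauss_dvdpl // (_ : y + 2 = 'X - 0%:P); last by rewrite /y subr0 subrK.
  rewrite coprimep_XsubC; apply/negP => g0.
  have : root Q^`() 0 by move: g0; rewrite root_gcd => /andP[].
  rewrite /Q /y -pFp_hseq pFp_deriv /root -[0]/(0%:~R) pFp_horner.
  rewrite -(dvdz_pcharf (pchar_Fp pp)); apply/negP.
  exact: deriv_hseq_at0_ndvd.
have Yn c : y - c%:P != 0 by rewrite Dy -addrA -opprD -polyCD polyXsubC_eq0.
have sY c : size (y - c%:P) = 2%N by rewrite Dy -addrA -opprD -polyCD size_XsubC.
have yn : y != 0 by rewrite -[y]subr0 Yn.
pose A := hseq y j; pose B := hneg y j.+1.
have An : A != 0 := monic_neq0 Am; have Bn : B != 0 := monic_neq0 Bm.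
have y4 : y - 4 != 0 by rewrite -polyC_natr Yn.
have y2 : y + 2 != 0 by rewrite -[2]opprK -polyC_natr -polyCN Yn.
have szy : size y = 2%N by rewrite -[y]subr0 sY.
have szy4 : size (y - 4) = 2%N by rewrite -polyC_natr sY.
have szy2 : size (y + 2) = 2%N by rewrite -[2]opprK -polyC_natr -polyCN sY.
have := @finField_roots_count _ Q (y * (y - 4)) (y * (y + 2) * (A * B)) N.
rewrite card_Fp // !mulf_neq0 // monic_neq0 // => /(_ isT QN gf isT isT) bound.
have : (size Q < size (y * (y + 2) * (A * B))%R + size (y * (y - 4))%R)%N.
  apply: bound => x; rewrite /root /Q horner_hseq => /eqP Qx.
  have yx : y.[x] = x - 2 by rewrite Dy hornerXsubC.
  have e2 : (y + 2).[x] = x by rewrite hornerD yx horner_natr subrK.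
  rewrite 3!hornerM e2 yx /A /B.
  have [->|x0] := eqVneq (x - 2) 0; first by rewrite !mul0r.
  have [->|x2] := eqVneq x 0; first by rewrite mulr0 !mul0r.
  (* y = 2 is not a root of Q: the value there is 2 - (2n + 1) = 2. *)
  have x4 : (x - 2) ^+ 2 - 4 != 0.
    rewrite (_ : _ - 4 = x * (x - 4)); last by ring.
    rewrite mulf_neq0 // subr_eq0; apply: contra_eq_neq Qx => ->.
    rewrite (_ : 4 - 2 = 2); last by ring.
    rewrite hseq_at2 (_ : _ - _ = 2 - (2 * n%:R + 1)); last by ring.
    by rewrite n21 subr0; apply: nz; apply: leq_trans p5.
  have [/(_ _)[]] := hseq_Fp_roots pp x0 x4 Dlj Qx.
  - by rewrite mulnC -Dl.
  - by rewrite -horner_hseq => -> _; rewrite mul0r mulr0.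
  - by rewrite -horner_hneg => -> _; rewrite !mulr0.
rewrite !size_mul ?mulf_neq0 // szy szy4 szy2 sQ /A /B sA sB.
have := odd_mul_bound lodd p5; rewrite -Dl.
by move: n3 Dlj; clearbody j; clear; lia.
Qed.
(** The same count at y = 2: W has degree at most 4j + 5 = 2l + 3 and f at most 2, whence 2n - 1 <=
    2l + 4. *)
Lemma hseq_Fp_nosplit_pred (p n : nat) : prime p -> (5 <= p)%N -> (4 <= n)%N ->
    (p %| n.*2.-1)%N ->
  ~ exists N, pFp p (hseq ('X - 2) n) %| ('X^p - 'X) ^+ N.
Proof.
move=> pp p5 n4 pn [N]; rewrite pFp_hseq.
set y : {poly 'F_p} := 'X - 2; set Q := hseq y n => QN.
have Dy : y = 'X - 2%:P by rewrite polyC_natr.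
have [l Dl] := dvdnP pn; pose j := l./2.
have Sn : n.*2 = n.*2.-1.+1 by rewrite prednK // double_gt0; apply: leq_trans n4.
have lodd : odd l.
  have := congr1 odd Sn; rewrite Dl /= odd_double oddM.
  by case: (odd l).
have Dlj : l = j.*2.+1 by rewrite -[LHS]odd_double_half lodd.
have [Qm sQ] := hseq_size (2 : 'F_p) n; rewrite -Dy -/Q in Qm sQ.
have [Am sA] := hseq_size (2 : 'F_p) j.+1; rewrite -Dy in Am sA.
have [Bm _] := hneg_size (2 : 'F_p) j; rewrite -Dy in Bm.
(* At j = 0 the size is 1 and not 2j, so only a bound is uniform in j. *)
have sB : (size (hneg y j) <= j.*2.+1)%N.
  case: (j) => [|i]; first by rewrite /hneg /= size_poly1.
  by have [_] := hneg_size (2 : 'F_p) i; rewrite -Dy => ->.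
have nz k : (0 < k < p)%N -> (k%:R : 'F_p) != 0.
  by case/andP=> k0 kp; rewrite -(dvdn_pcharf (pchar_Fp pp)) gtnNdvd.
have n21 : (2 * n%:R - 1 : 'F_p) = 0.
  rewrite (_ : _ - 1 = n.*2.-1%:R); last first.
    by apply/eqP; rewrite subr_eq -[1]/(1%:R) -natrD addn1 -Sn -mul2n natrM.
  by apply/eqP; rewrite -(dvdn_pcharf (pchar_Fp pp)).
pose f := 3 * y ^+ 2 + (8 * y + 8).
have gf : gcdp Q Q^`() %| f.
  (* As 2n - 1 = 0 in F_p, [gcdp_hseq] leaves f (y - 2); y - 2 drops out because X = 4 is a simple
     root of Q. *)
  have : gcdp Q Q^`() %| f * (y - 2).
    have := gcdp_hseq n pp p5; rewrite -/y -/Q.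
    have -> : (4 * n%:R - 2) * (4 + 4 * y - y ^+ 3)
                  + (16 + 8 * y - 2 * y ^+ 2 - 3 * y ^+ 3)
       = 2 * (2 * n%:R - 1) * (4 + 4 * y - y ^+ 3) - f * (y - 2) by rewrite /f; ring.
    rewrite (_ : 2 * n%:R - 1 = (2 * n%:R - 1)%:P :> {poly 'F_p}).
      by rewrite n21 mulr0 mul0r sub0r dvdpNr.
    by rewrite polyCB polyCM !polyC_natr.
  have D4 : y - 2 = 'X - 4%:P by rewrite /y polyC_natr; ring.
  rewrite Gauss_dvdpl // D4.
  rewrite coprimep_XsubC; apply/negP => g0.
  have : root Q^`() 4 by move: g0; rewrite root_gcd => /andP[].
  have -> : (4 : 'F_p) = (4 : int)%:~R by [].
  rewrite /Q /y -pFp_hseq pFp_deriv /root pFp_horner.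
  rewrite -(dvdz_pcharf (pchar_Fp pp)); apply/negP.
  by apply: deriv_hseq_at4_ndvd => //; apply: leq_trans n4.
have Yn c : y - c%:P != 0 by rewrite Dy -addrA -opprD -polyCD polyXsubC_eq0.
have sY c : size (y - c%:P) = 2%N by rewrite Dy -addrA -opprD -polyCD size_XsubC.
have yn : y != 0 by rewrite -[y]subr0 Yn.
have szy : size y = 2%N by rewrite -[y]subr0 sY.
have sf : (size f <= 3)%N.
  rewrite (leq_trans (size_polyD _ _)) // geq_max -!polyC_natr !mul_polyC.
  rewrite (leq_trans (size_scale_leq _ _)) ?Dy ?size_exp_XsubC //=.
  rewrite (leq_trans (size_polyD _ _)) // geq_max (leq_trans (size_scale_leq _ _)) ?size_XsubC //=.
  by rewrite (leq_trans (size_polyC_leq1 _)).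
have fn : f != 0.
  have : f.[2] != 0.
    rewrite /f Dy hornerD hornerM horner_exp hornerXsubC subrr expr0n mulr0 add0r.
    rewrite hornerD hornerM hornerXsubC subrr mulr0 add0r horner_natr.
    rewrite -(dvdn_pcharf (pchar_Fp pp)) -[8%N]/(2 ^ 3)%N Euclid_dvdX // andbT.
    by rewrite gtnNdvd //; apply: leq_trans p5.
  by apply: contra_neq => ->; rewrite horner0.
pose A := hseq y j.+1; pose B := hneg y j.
have An : A != 0 := monic_neq0 Am; have Bn : B != 0 := monic_neq0 Bm.
have y4 : y - 2 != 0 by rewrite -polyC_natr Yn.
have y2 : y + 2 != 0 by rewrite -[2]opprK -polyC_natr -polyCN Yn.
have szy4 : size (y - 2) = 2%N by rewrite -polyC_natr sY.
have szy2 : size (y + 2) = 2%N by rewrite -[2]opprK -polyC_natr -polyCN sY.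
have := @finField_roots_count _ Q f (y * ((y - 2) * (y + 2)) * (A * B)) N.
rewrite card_Fp // !mulf_neq0 // monic_neq0 // => /(_ isT QN gf fn isT) bound.
have : (size Q < size (y * ((y - 2) * (y + 2)) * (A * B))%R + size f)%N.
  apply: bound => x; rewrite /root /Q horner_hseq => /eqP Qx.
  have yx : y.[x] = x - 2 by rewrite Dy hornerXsubC.
  have e4 : ((y - 2) * (y + 2)).[x] = (x - 2) ^+ 2 - 4.
    have e2 : (y + 2).[x] = x by rewrite hornerD yx horner_natr subrK.
    have e2' : (y - 2).[x] = x - 2 - 2 by rewrite hornerD yx hornerN horner_natr.
    by rewrite hornerM e2 e2'; ring.
  rewrite hornerM (hornerM y) (hornerM A) e4 yx /A /B.
  have [->|x0] := eqVneq (x - 2) 0; first by rewrite !mul0r.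
  have [->|x4] := eqVneq ((x - 2) ^+ 2 - 4) 0; first by rewrite mulr0 !mul0r.
  have [_ /(_ _)[]] := hseq_Fp_roots pp x0 x4 Dlj Qx.
  - by rewrite Sn Dl mulnC.
  - by rewrite -horner_hseq => ->; rewrite mul0r mulr0.
  - by rewrite -horner_hneg => ->; rewrite !mulr0.
rewrite !size_mul ?mulf_neq0 // szy szy4 szy2 sQ /A /B sA.
have := odd_mul_bound lodd p5; rewrite -Dl.
move: sf sB n4 Dlj; move: (size f) (size (hneg y j)) => a b.
by clearbody j; clear; lia.
Qed.
(** * Conclusion *)

(** Automorphisms send w to powers of w, so they commute; in an abelian Galois group every subgroup
    is normal, and every subfield is Galois. *)
Lemma cyclotomic_subfield_galois n (zeta x : algC) :
    (0 < n)%N -> n.-primitive_root zeta -> in_Qadj zeta x ->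
  exists (L : splittingFieldType rat) (iota : {rmorphism L -> algC}) (z : L),
    iota z = x /\ galois 1%VS <<1; z>>%VS.
Proof.
move=> n0 prim [P Dx].
(* Only the order n of this group matters. *)
have [L galL [iota _ [w [prim_w Dw] _]]] := group_num_field_exists [set: 'I_n.-1.+1].
rewrite cardsT card_ord prednK // in prim_w.
have prim_iw : n.-primitive_root (iota w) by rewrite fmorph_primitive_root.
have [|i Dzeta] := (prim_rootP prim_iw) zeta; first exact: prim_expr_order prim.
pose z := (map_poly ratr P).[w ^+ i].
exists L, iota, z; split.
  by rewrite horner_map_ratr rmorphXn -Dzeta Dx.
pose M := <<1; z>>%AS.
have sKME : (1 <= M <= {:L})%VS by rewrite sub1v subvf.
have galM' := galoisS sKME galL.
have abel : abelian 'Gal({:L} / 1).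
  apply/centsP => a _ b _; apply/eqP/gal_eqP => t _.
  have pw (c : gal_of {:L}) : exists k : nat, c w = w ^+ k.
    have [|k ->] := (prim_rootP prim_w) (c w); last by exists k.
    by rewrite -rmorphXn (prim_expr_order prim_w) rmorph1.
  have [[ka Ha] [kb Hb]] := (pw a, pw b).
  have : t \in <<1; w>>%VS by rewrite Dw memvf.
  case/Fadjoin_polyP => u /polyOver1_ratr[h ->] ->.
  have hm (c : gal_of {:L}) v : c (map_poly ratr h).[v] = (map_poly ratr h).[c v].
    exact: (horner_map_ratr c).
  by rewrite !galM ?memvf // !hm Ha Hb !rmorphXn /= Ha Hb -!exprM mulnC.
have <- : fixedField 'Gal({:L} / M)%g = <<1; z>>%VS by apply/galois_fixedField.
apply: (normal_fixedField_galois galL).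
by rewrite /normal galS ?sub1v // (subset_trans _ (sub_abelian_norm abel _)) // galS ?sub1v.
Qed.

Lemma prime_factor_ge5 m : odd m -> (1 < m)%N -> ~~ (3 %| m)%N ->
  exists p, [/\ prime p, (5 <= p)%N & (p %| m)%N].
Proof.
move=> om m1 m3; exists (pdiv m); have pp := pdiv_prime m1.
split=> //; last exact: pdiv_dvd.
have pm := pdiv_dvd m; have p2 := prime_gt1 pp.
have n2 : pdiv m != 2%N by apply: contraTneq om => E; rewrite -dvdn2 -E pm.
have n3 : pdiv m != 3%N by apply: contraNneq m3 => <-.
have n4 : pdiv m != 4%N by apply: contraTneq pp => ->.
by move: p2 n2 n3 n4; case: (pdiv m) => [|[|[|[|[|?]]]]].
Qed.

Lemma largest_root_hseq k d : largest_real_root k d ->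
  [/\ d \is Num.real, hseq (d - 2) k.+1 = 0 &
      forall x, x \is Num.real -> hseq (x - 2) k.+1 = 0 -> x <= d].
Proof.
have E x : root (qC k) x = (hseq (x - 2) k.+1 == 0).
  by rewrite /qC q_hseq evC_rootE evC_hseq.
case=> dr; rewrite E => /eqP d0 dmax; split=> // x xr x0.
by apply: dmax xr _; rewrite E x0.
Qed.

Lemma largest_root_not_galois k (L : splittingFieldType rat)
    (iota : {rmorphism L -> algC}) (z : L) :
  (2 <= k)%N -> largest_real_root k (iota z) -> ~~ galois 1%VS <<1; z>>%VS.
Proof.
move=> k2 /largest_root_hseq[dr d0 dmax]; apply/negP => gal.
set n := k.+1 in d0 dmax.
have n3 : (3 <= n)%N by [].
have split_p (p : nat) (c : int) := @galois_hseq_dvdp L iota z _ n p c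
  erefl gal (ltn0Sn k) dr d0 dmax.
(* 3 cannot divide both 2n + 1 and 2n - 1. The first is used with c = 0 (y = -2), the second with c
   = 4 (y = 2). *)
have [d3|nd3] := boolP (3 %| n.*2.+1)%N; last first.
  have [p [pp p5 pn]] : exists p, [/\ prime p, (5 <= p)%N & (p %| n.*2.+1)%N].
    by apply: prime_factor_ge5 nd3; rewrite ?ltnS //= odd_double.
  apply: (hseq_Fp_nosplit_succ pp p5 n3 pn); apply: (split_p p 0) => //.
  - by rewrite horner_hseq sub0r hseq_atN2 natz dvdzE; move: pn; congr (_ %| _)%N; lia.
  - exact: deriv_hseq_at0_ndvd.
  by rewrite sub0r rpredN; apply: (@dvdz_small p 1); rewrite prime_gt1.
(* For n = 3, 2n + 1 = 7 is prime to 3. *)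
have n4 : (4 <= n)%N by move: d3 n3; case: (n) => [|[|[|[|]]]].
have [p [pp p5 pn]] : exists p, [/\ prime p, (5 <= p)%N & (p %| n.*2.-1)%N].
  apply: prime_factor_ge5; last first.
  - have Sn : n.*2.+1 = (n.*2.-1 + 2)%N by lia.
    by rewrite Sn in d3; apply/negP => d3'; move: d3; rewrite dvdn_addr.
  - by lia.
  by rewrite (_ : n.*2.-1 = k.*2.+1) /= ?odd_double.
apply: (hseq_Fp_nosplit_pred pp p5 n4 pn); apply: (split_p p 4) => //.
- rewrite horner_hseq (_ : 4 - 2 = 2) // hseq_at2 natz dvdzE; move: pn; congr (_ %| _)%N; lia.
- exact: deriv_hseq_at4_ndvd.
by apply: (@dvdz_small p 3); apply: leq_trans p5.
Qed.

Theorem mainTheorem9 (k : nat) (d : algC) :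
  (2 <= k)%N -> largest_real_root k d ->
  (* Q(d_k)/Q is not Galois: in any number field L (taken normal over Q, i.e. a splittingFieldType) with an embedding
     iota : L -> algC hitting d_k, the subfield Q(z) with iota z = d_k is not
     Galois over Q *)
  (forall (L : splittingFieldType rat) (iota : {rmorphism L -> algC}) (z : L),
      iota z = d -> ~~ galois 1%VS <<1; z>>%VS)
  /\
  (* d_k is not a cyclotomic integer: it lies in no cyclotomic field Q(zeta_n) *)
  (forall (n : nat) (zeta : algC), (0 < n)%N -> n.-primitive_root zeta ->
      ~ in_Qadj zeta d).
Proof.
move=> k2 dk.
have notgal (L : splittingFieldType rat) (iota : {rmorphism L -> algC}) (z : L) :
    iota z = d -> ~~ galois 1%VS <<1; z>>%VS.
  by move=> zd; move: dk; rewrite -zd; apply: largest_root_not_galois.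
split=> // n zeta n0 prim /(cyclotomic_subfield_galois n0 prim).
case=> [L [iota [z [zd gal]]]].
by have := notgal L iota z zd; rewrite gal.
Qed.
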